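(* Let $(G,g)$ be a connected almost abelian Lie group endowed with a left-invariant Riemannian metric. If $(G,g)$ is flat, then every left-invariant symmetric Killing $p$-tensor on $G$ can be written as a polynomial (with real coefficients, with respect to the symmetric product) in left-invariant and right-invariant Killing vector fields of $(G,g)$.
   Context: A Lie group is almost abelian if its Lie algebra contains an abelian ideal of codimension 1. For a vector space $V$, $\mathrm{Sym}^p(V)\subset V^{\otimes p}$ is spanned by the symmetric products $v_1\cdot\ldots\cdot v_p:=\sum_{\sigma\in\mathfrak S_p}v_{\sigma(1)}\otimes\ldots\otimes v_{\sigma(p)}$; $\mathrm{Sym}^0(V)=\mathbb R$. The symmetric product makes $\mathrm{Sym}^\bullet(V)$ the commutative symmetric algebra of $V$, and it is applied pointwise to symmetric tensor fields. On a Riemannian manifold $(M,g)$ with Levi-Civita connection $\nabla$, a symmetric $p$-tensor is a section of $\mathrm{Sym}^p(TM)$; the Killing operator is $\mathrm d(K)=\sum_i e_i\cdot\nabla_{e_i}K\in\Gamma(\mathrm{Sym}^{p+1}TM)$ for a local orthonormal frame $\{e_i\}$, and $K$ is Killing if $\mathrm d(K)=0$. For $p=1$ these are the Killing vector fields. A tensor field $S$ on $G$ is left-invariant if $(\mathcal L_a)_*S=S$ for all $a\in G$, where $\mathcal L_a(u)=au$; a right-invariant vector field is one of the form $(\xi_x)_u=(\mathcal R_u)_*x$, $x\in\mathfrak g$, where $\mathcal R_u(v)=vu$ (these are always Killing for a left-invariant metric). *)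

(* Defs.v *)
From HB Require Import structures.
From mathcomp Require Import all_boot all_order all_algebra all_fingroup.
From mathcomp Require Import all_classical all_reals all_analysis.
Set Implicit Arguments.
Unset Strict Implicit.
Unset Printing Implicit Defensive.
Import Order.TTheory GRing.Theory Num.Theory.
Import numFieldNormedType.Exports.
Local Open Scope classical_set_scope.
Local Open Scope ring_scope.

(* Meant for open [U] and finite-dimensional [V]; there, being C^k for every k
   is the usual C^oo condition. *)
Fixpoint Ck (R : realType) (V W : normedModType R) (k : nat) (U : set V)
    (f : V -> W) {struct k} : Prop :=
  match k with
  | 0 => forall x, U x -> {for x, continuous f}
  | k'.+1 => (forall x, U x -> differentiable f x) /\
             (forall v, Ck k' U (fun x => 'D_v f x))
  end.

Definition smooth_on (R : realType) (V W : normedModType R) (U : set V)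
  (f : V -> W) : Prop := forall k, Ck k U f.

(* The atlas is indexed by the points of the manifold: [chart a] is a chart
   whose domain [chart_dom a] contains [a].  [chart a] and its inverse
   [chart_inv a] are total functions, meaningful only on [chart_dom a] and on
   [chart a @` chart_dom a]. *)
HB.mixin Record Topological_isManifold (R : realType) (n : nat) M
    of Topological M := {
  chart_dom : M -> set M;
  chart : M -> M -> 'rV[R]_n;
  chart_inv : M -> 'rV[R]_n -> M;
  manifold_hausdorff : hausdorff_space M;
  manifold_second_countable : @second_countable M;
  chart_domP : forall a, chart_dom a a;
  chart_dom_open : forall a, open (chart_dom a);
  chart_cod_open : forall a, open (chart a @` chart_dom a);
  chartK : forall a u, chart_dom a u -> chart_inv a (chart a u) = u;
  chart_continuous : forall a u, chart_dom a u -> {for u, continuous (chart a)};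
  chart_inv_continuous : forall a x, (chart a @` chart_dom a) x ->
    {for x, continuous (chart_inv a)};
  chart_transition_smooth : forall a b,
    smooth_on (chart a @` (chart_dom a `&` chart_dom b))
              (chart b \o chart_inv a) }.

#[short(type="manifoldType")]
HB.structure Definition Manifold (R : realType) (n : nat) :=
  { M of Topological M & Topological_isManifold R n M }.

HB.mixin Record Manifold_Group_isLieGroup (R : realType) (n : nat) G
    of Manifold R n G & monoid.Group G := {
  lie_mul_continuous : continuous (fun p : G * G => (p.1 * p.2)%g);
  lie_mul_smooth : forall a b c : G,
    smooth_on
      [set p : 'rV[R]_n * 'rV[R]_n |
        [/\ (chart a @` chart_dom a) p.1, (chart b @` chart_dom b) p.2 &
            chart_dom c (chart_inv a p.1 * chart_inv b p.2)%g]]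
      (fun p => chart c (chart_inv a p.1 * chart_inv b p.2)%g);
  lie_inv_continuous : continuous (fun u : G => (u^-1)%g);
  lie_inv_smooth : forall a b : G,
    smooth_on (chart a @` (chart_dom a `&` [set u | chart_dom b (u^-1)%g]))
              (fun x => chart b ((chart_inv a x)^-1)%g) }.

#[short(type="lieGroupType")]
HB.structure Definition LieGroup (R : realType) (n : nat) :=
  { G of Manifold R n G & monoid.Group G & Manifold_Group_isLieGroup R n G }.

(* [tensor R n p] is the p-th tensor power of 'rV[R]_n, in coordinates with
   respect to the standard basis e: [T i] is the coefficient of
   e_(i 0) (x) ... (x) e_(i (p-1)). *)
Notation tensor R n p := {ffun {ffun 'I_p -> 'I_n} -> R^o}.

Section Tensors.
Context {R : realType} {n : nat}.
Implicit Types p q : nat.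

Definition vec_tensor (v : 'rV[R]_n) : tensor R n 1 := [ffun i : {ffun 'I_1 -> 'I_n} => v 0 (i ord0)].

Definition tensor_vec (T : tensor R n 1) : 'rV[R]_n := \row_j T [ffun=> j].

Definition pure_tensor p (v : 'I_p -> 'rV[R]_n) : tensor R n p :=
  [ffun i : {ffun 'I_p -> 'I_n} => \prod_(k < p) v k 0 (i k)].

Definition tensor_mul p q (K : tensor R n p) (L : tensor R n q) :
    tensor R n (p + q) :=
  [ffun i : {ffun 'I_(p + q) -> 'I_n} =>
     K [ffun k => i (lshift q k)] * L [ffun k => i (rshift p k)]].

Definition perm_tensor p (s : 'S_p) (K : tensor R n p) : tensor R n p :=
  [ffun i : {ffun 'I_p -> 'I_n} => K [ffun k => i (s k)]].

(* The p-th tensor power of [A], which is meant to be linear *)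
Definition push_tensor p (A : 'rV[R]_n -> 'rV[R]_n) (K : tensor R n p) :
    tensor R n p :=
  [ffun i : {ffun 'I_p -> 'I_n} => \sum_(j : {ffun 'I_p -> 'I_n})
     K j * \prod_(k < p) A (delta_mx 0 (j k)) 0 (i k)].

(* The symmetric product of vectors is normalized without the factor 1/p!. *)
Definition sym_prod p (v : 'I_p -> 'rV[R]_n) : tensor R n p :=
  \sum_(s : 'S_p) pure_tensor (fun k => v (s k)).

Definition is_sym p (K : tensor R n p) : Prop :=
  exists (m : nat) (c : 'I_m -> R) (v : 'I_m -> 'I_p -> 'rV[R]_n),
    K = \sum_(j < m) c j *: sym_prod (v j).

(* The product of the symmetric algebra: with this normalization,
   (v_1 . ... . v_p) . (w_1 . ... . w_q) = v_1 . ... . v_p . w_1 . ... . w_q. *)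
Definition sym_mul p q (K : tensor R n p) (L : tensor R n q) :
    tensor R n (p + q) :=
  (p`! * q`!)%:R^-1 *: \sum_(s : 'S_(p + q)) perm_tensor s (tensor_mul K L).

End Tensors.

(* The tangent space at [u] is 'rV[R]_n, a tangent vector being given by its
   coordinates in the chart [chart u].  Accordingly vector fields are functions
   M -> 'rV[R]_n and contravariant p-tensor fields functions M -> tensor R n p;
   in both cases the value at [u] refers to [chart u]. *)
Section Manifolds.
Context {R : realType} {n : nat} {M : manifoldType R n}.
Local Notation V := 'rV[R]_n.
Implicit Types (u : M) (X Y Z : M -> V) (f : M -> R).

Definition tangent_map (h : M -> M) u : V -> V :=
  'd (chart (h u) \o h \o chart_inv u) (chart u u).

(* From the coordinates in [chart u] to the coordinates in [chart a], at [u] *)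
Definition coord_change (a u : M) : V -> V :=
  'd (chart a \o chart_inv u) (chart u u).

Definition smooth_fun f : Prop :=
  forall a : M, smooth_on (chart a @` chart_dom a) ((f : M -> R^o) \o chart_inv a).

Definition smooth_field p (K : M -> tensor R n p) : Prop :=
  forall (a : M) (i : {ffun 'I_p -> 'I_n}),
    smooth_on (chart a @` chart_dom a)
      (fun x : V => push_tensor (coord_change a (chart_inv a x))
                                (K (chart_inv a x)) i : R^o).

Definition vfield_tensor X : M -> tensor R n 1 := fun u => vec_tensor (X u).

Definition smooth_vfield X : Prop := smooth_field (vfield_tensor X).

Definition vfield_app X f : M -> R :=
  fun u => 'D_(X u) ((f : M -> R^o) \o chart_inv u) (chart u u).

Definition local_rep (a : M) X : V -> V :=
  fun x => coord_change a (chart_inv a x) (X (chart_inv a x)).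

(* [X, Y]^k = X^i d_i Y^k - Y^i d_i X^k, computed at [u] in [chart u] *)
Definition lie_bracket X Y : M -> V := fun u =>
  'D_(X u) (local_rep u Y) (chart u u) - 'D_(Y u) (local_rep u X) (chart u u).

Record riemannian_metric (g : M -> V -> V -> R) : Prop := {
  metric_linear : forall u (c : R) (v w z : V),
    g u (c *: v + w) z = c * g u v z + g u w z;
  metric_sym : forall u (v w : V), g u v w = g u w v;
  metric_posdef : forall u (v : V), v != 0 -> 0 < g u v v;
  metric_smooth : forall X Y, smooth_vfield X -> smooth_vfield Y ->
    smooth_fun (fun u => g u (X u) (Y u)) }.

(* A covariant derivative acting on tensor fields of every degree: [D p X K]
   is nabla_X K.  It is only constrained on smooth fields. *)
Definition tensor_derivative :=
  forall p, (M -> V) -> (M -> tensor R n p) -> (M -> tensor R n p).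

Definition vfield_derivative (D : tensor_derivative) X Y : M -> V :=
  fun u => tensor_vec (D 1%N X (vfield_tensor Y) u).

(* [D] consists of a linear connection on TM together with the connections it
   induces on the tensor powers of TM: these are determined by
   nabla_X f = X f and by the Leibniz rule for (x). *)
Record linear_connection (D : tensor_derivative) : Prop := {
  conn_smooth : forall p X (K : M -> tensor R n p),
    smooth_vfield X -> smooth_field K -> smooth_field (D p X K);
  conn_addl : forall p X Y (K : M -> tensor R n p),
    smooth_vfield X -> smooth_vfield Y -> smooth_field K ->
    forall u, D p (fun w => X w + Y w) K u = D p X K u + D p Y K u;
  conn_scalel : forall p f X (K : M -> tensor R n p),
    smooth_fun f -> smooth_vfield X -> smooth_field K ->
    forall u, D p (fun w => f w *: X w) K u = f u *: D p X K u;
  conn_addr : forall p X (K L : M -> tensor R n p),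
    smooth_vfield X -> smooth_field K -> smooth_field L ->
    forall u, D p X (fun w => K w + L w) u = D p X K u + D p X L u;
  conn_leibniz : forall p X f (K : M -> tensor R n p),
    smooth_vfield X -> smooth_fun f -> smooth_field K ->
    forall u, D p X (fun w => f w *: K w) u =
              vfield_app X f u *: K u + f u *: D p X K u;
  conn_deg0 : forall X (K : M -> tensor R n 0),
    smooth_vfield X -> smooth_field K ->
    forall u i, D 0%N X K u i = vfield_app X (fun w => K w i) u;
  conn_tensor : forall p q X (K : M -> tensor R n p) (L : M -> tensor R n q),
    smooth_vfield X -> smooth_field K -> smooth_field L ->
    forall u, D (p + q)%N X (fun w => tensor_mul (K w) (L w)) u =
              tensor_mul (D p X K u) (L u) + tensor_mul (K u) (D q X L u) }.

Record levi_civita (g : M -> V -> V -> R) (D : tensor_derivative) : Prop := {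
  lc_connection : linear_connection D;
  lc_torsion_free : forall X Y, smooth_vfield X -> smooth_vfield Y ->
    forall u, vfield_derivative D X Y u - vfield_derivative D Y X u =
              lie_bracket X Y u;
  lc_metric : forall X Y Z,
    smooth_vfield X -> smooth_vfield Y -> smooth_vfield Z ->
    forall u, vfield_app X (fun w => g w (Y w) (Z w)) u =
              g u (vfield_derivative D X Y u) (Z u) +
              g u (Y u) (vfield_derivative D X Z u) }.

Definition curvature (D : tensor_derivative) X Y Z : M -> V := fun u =>
  vfield_derivative D X (vfield_derivative D Y Z) u
  - vfield_derivative D Y (vfield_derivative D X Z) u
  - vfield_derivative D (lie_bracket X Y) Z u.

Definition flat (D : tensor_derivative) : Prop := forall X Y Z,
  smooth_vfield X -> smooth_vfield Y -> smooth_vfield Z ->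
  forall u, curvature D X Y Z u = 0.

Definition symmetric_field p (K : M -> tensor R n p) : Prop :=
  smooth_field K /\ forall u, is_sym (K u).

(* A local orthonormal frame around [u], each member of which is the
   restriction of a global vector field *)
Definition orthonormal_frame_near (g : M -> V -> V -> R) (e : 'I_n -> M -> V)
    u : Prop :=
  (forall i, smooth_vfield (e i)) /\
  \forall w \near u, forall i j, g w (e i w) (e j w) = (i == j)%:R.

Definition killing_op (D : tensor_derivative) (e : 'I_n -> M -> V) p
    (K : M -> tensor R n p) : M -> tensor R n (1 + p) :=
  fun u => \sum_(i < n) sym_mul (vec_tensor (e i u)) (D p (e i) K u).

(* The value of [killing_op D e K] at [u] does not depend on the frame [e], and
   such frames exist around every point. *)
Definition killing (g : M -> V -> V -> R) (D : tensor_derivative) p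
    (K : M -> tensor R n p) : Prop :=
  forall u e, orthonormal_frame_near g e u -> killing_op D e K u = 0.

Definition killing_vfield (g : M -> V -> V -> R) (D : tensor_derivative) X :=
  smooth_vfield X /\ killing g D (vfield_tensor X).

(* The symmetric algebra is graded, so a p-tensor field which is a polynomial
   in some vector fields is a linear combination of monomials of degree p. *)
Definition polynomial_in (P : (M -> V) -> Prop) p (S : M -> tensor R n p) :=
  exists (m : nat) (c : 'I_m -> R) (X : 'I_m -> 'I_p -> M -> V),
    (forall j k, P (X j k)) /\
    forall u, S u = \sum_(j < m) c j *: sym_prod (fun k => X j k u).

End Manifolds.

Section LieGroups.
Context {R : realType} {n : nat} {G : lieGroupType R n}.
Local Notation V := 'rV[R]_n.

Definition ltrans (a : G) : G -> G := fun u => (a * u)%g.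
Definition rtrans (u : G) : G -> G := fun v => (v * u)%g.

Definition left_invariant p (S : G -> tensor R n p) : Prop :=
  forall a u : G, push_tensor (tangent_map (ltrans a) u) (S u) = S (a * u)%g.

Definition left_invariant_vfield (X : G -> V) : Prop :=
  left_invariant (vfield_tensor X).

Definition right_invariant_vfield (X : G -> V) : Prop :=
  exists x : V, forall u, X u = tangent_map (rtrans u) 1%g x.

Definition left_invariant_metric (g : G -> V -> V -> R) : Prop :=
  forall (a u : G) (v w : V),
    g (a * u)%g (tangent_map (ltrans a) u v) (tangent_map (ltrans a) u w)
    = g u v w.

(* The Lie algebra is the tangent space at 1, with the bracket of left-invariant
   vector fields. *)
Definition left_vfield (x : V) : G -> V :=
  fun u => tangent_map (ltrans u) 1%g x.

Definition lie_algebra_bracket (x y : V) : V :=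
  lie_bracket (left_vfield x) (left_vfield y) 1%g.

End LieGroups.

Definition almost_abelian (R : realType) (n : nat) (G : lieGroupType R n) :=
  exists h : {vspace 'rV[R]_n},
    [/\ (\dim h).+1 = n,
        forall x y, y \in h -> @lie_algebra_bracket R n G x y \in h &
        forall x y, x \in h -> y \in h -> @lie_algebra_bracket R n G x y = 0].

(* Main.v *)
(* Let e_0, e_1, .., e_m be an orthonormal basis of the Lie algebra with e_1, .., e_m
   in the abelian ideal h, and E_i the left-invariant field of e_i.  By the Koszul
   formula the connection has constant coefficients in the frame E, and the trace
   of R(E_0, .)E_0 is the squared norm of the symmetric part of ad e_0 on h.
   Flatness thus makes ad e_0 skew and leaves nabla_(E_0) E_j = [E_0, E_j] as the
   only nonzero derivatives.  The Killing equation of a left-invariant S becomes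
   E_0 . (ad e_0) S = 0, and multiplication by E_0 is injective, so ad e_0
   annihilates the coefficients of S.  Now let X_0 = E_0 and let X_i, i > 0, be the
   right-invariant field of e_i.  Left- and right-invariant fields commute, which
   gives the derivatives of the matrix phi of X in the frame E; as ad e_0 acts on
   tensors by a skew endomorphism, replacing each E_i by X_i in the expression of S
   yields a field at constant distance from S, and the two agree at 1. *)

Require Import Defs.
From HB Require Import structures.
From mathcomp Require Import all_boot all_order all_algebra all_fingroup.
From mathcomp Require Import all_classical all_reals all_analysis.
From mathcomp Require Import lra.
Set Implicit Arguments.
Unset Strict Implicit.
Unset Printing Implicit Defensive.
Import Order.TTheory GRing.Theory Num.Theory.
Import numFieldNormedType.Exports.
Local Open Scope classical_set_scope.
Local Open Scope ring_scope.

(** * Second derivatives *)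

(** Why left- and right-invariant fields are mixed: for i > 0 the field E_i need not be Killing,
    whereas right-invariant fields always are. The right-invariant field of e_0 would still be a
    wrong X_0: in general its components along h vary in the directions of h, where the connection
    vanishes. E_0 is parallel, hence Killing. With this choice E_j phi = - phi B_j for every j,
    where B_j is the matrix of nabla_(E_j) in the frame. The coefficients of the difference between
    the substituted tensor and S thus solve a linear first-order system with value 0 at 1.
    Conservation of the norm on the connected group takes the place of uniqueness for differential
    equations, so neither flows nor the exponential map occur. Second-order calculus enters only
    through the brackets of invariant fields, which come down to the symmetry of mixed second
    derivatives of the group law in charts. The connection is constrained only on global smooth
    fields; the invariant frames are global, so all computations stay among such fields. *)

Section NearEq.
Context {R : realType} {V W : normedModType R}.

(** These are the two facts that [diff_unique] takes: the differential of [f] serves as a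
    first-order expansion of [g], since a little-o at 0 only sees nearby points. *)
Lemma near_eq_diff_locally (f g : V -> W) x : (\near x, f x = g x) ->
  differentiable f x -> continuous ('d f x) /\
  g \o shift x = cst (g x) + 'd f x +o_ 0 id.
Proof.
move=> fg df; split; first exact: diff_continuous.
have fgx := nbhs_singleton fg.
have := diff_locally df => /eqaddoP E.
apply/eqaddoP => e e0; have := E e e0.
have fg0 : \forall y \near 0, f (y + x) = g (y + x).
  by move: fg; rewrite (near_shift 0); apply: filterS => y /=; rewrite subr0.
apply: filterS2 fg0 => y Hy; congr (_ <= _); congr (`| _ |).
by rewrite /= !fctE /= Hy fgx.
Qed.

Lemma near_eq_differentiable (f g : V -> W) x : (\near x, f x = g x) ->
  differentiable f x -> differentiable g x.
Proof.
move=> fg df; have [c E] := near_eq_diff_locally fg df.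
by apply/diff_locallyP; rewrite (diff_unique c E).
Qed.

Lemma near_eq_diff (f g : V -> W) x : (\near x, f x = g x) ->
  differentiable f x -> 'd g x = 'd f x :> (V -> W).
Proof.
by move=> fg df; have [c E] := near_eq_diff_locally fg df; exact: diff_unique.
Qed.

End NearEq.

Lemma derive_comp (R : realType) (U V W : normedModType R)
    (f : U -> V) (g : V -> W) x v :
  differentiable f x -> differentiable g (f x) ->
  'D_v (g \o f) x = 'D_('D_v f x) g (f x).
Proof.
move=> df dg; rewrite deriveE; last exact: differentiable_comp.
by rewrite diff_comp //= !deriveE.
Qed.

Section Lines.
Context {R : realType} {V W : normedModType R}.

Lemma is_derive_line (f : V -> W) (x v : V) (t : R) :
  differentiable f (x + t *: v) ->
  is_derive t 1 (fun s : R => f (x + s *: v)) ('D_v f (x + t *: v)).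
Proof.
move=> df.
have dl : is_diff t (fun s : R => x + s *: v) ( *:%R ^~ v).
  apply: (is_diff_eq (is_diffD (is_diff_cst x t) (is_diff_scalel t v))).
  by rewrite add0r.
have dl' : differentiable (fun s : R => x + s *: v) t by exact: ex_diff.
split.
  by apply: diff_derivable; apply: (differentiable_comp (g:=f)).
rewrite -[LHS]/('D_1 (f \o (fun s : R => x + s *: v)) t) derive_comp //.
by rewrite [X in derive _ _ X]deriveE // diff_val scale1r.
Qed.

Lemma differentiable_line_continuous (f : V -> W) (x v : V) (a b : R) :
  (forall t, t \in `[a, b]%R -> differentiable f (x + t *: v)) ->
  {within `[a, b], continuous (fun s : R => f (x + s *: v))}.
Proof.
move=> df; apply: derivable_within_continuous => t tab.
by have [] := is_derive_line (df t tab).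
Qed.

End Lines.

(** * Mean value theorem on segments and symmetry of second derivatives *)

Section MeanValue.
Context {R : realType} {V : normedModType R}.
Implicit Type f : V -> R^o.

Lemma MVT_line f (x v : V) (a b : R) : a <= b ->
  (forall t, t \in `[a, b]%R -> differentiable f (x + t *: v)) ->
  exists2 c, c \in `[a, b]%R &
    f (x + b *: v) - f (x + a *: v) = 'D_v f (x + c *: v) * (b - a).
Proof.
move=> ab df.
have dl t : t \in `]a, b[%R ->
    is_derive t 1 (fun s : R => f (x + s *: v)) ('D_v f (x + t *: v)).
  by move=> tab; apply: is_derive_line; apply: df; exact: subset_itv_oo_cc.
exact: (MVT_segment ab dl (differentiable_line_continuous df)).
Qed.

(** Balls are convex, so the mean value theorem applies on the segment from [x] to [y]. *)
Lemma derive0_locally_cst f (U : set V) x : open U -> U x ->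
  (forall y, U y -> differentiable f y /\ forall v, 'D_v f y = 0) ->
  \forall y \near x, f y = f x.
Proof.
move=> oU Ux f0.
have /nbhs_ballP[e /= e0 eU] : nbhs x U by exact: open_nbhs_nbhs.
apply/nbhs_ballP; exists e => //= y xy.
have inU (t : R) : t \in `[0, 1]%R -> U (x + t *: (y - x)).
  rewrite in_itv /= => /andP[t0 t1]; apply: eU.
  move: xy; rewrite -!ball_normE /= => xy.
  rewrite opprD addNKr normrN normrZ ger0_norm // distrC.
  by apply: le_lt_trans xy; rewrite ler_piMl.
have [c c01] := MVT_line ler01 (fun t t01 => (f0 _ (inU t t01)).1).
rewrite scale1r scale0r addr0 [x + _]addrC subrK (f0 _ (inU c c01)).2 mul0r.
by move/eqP; rewrite subr_eq0 => /eqP.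
Qed.

(** Two mean value theorems: one along [v] for the increment of [f] by [h *: w], whose derivative is
    an increment of ['D_v f], and one along [w] for ['D_v f]. *)
Lemma second_difference f (U : set V) (x v w : V) (h : R) : 0 <= h ->
  (forall s t : R, s \in `[0, h]%R -> t \in `[0, h]%R -> U (x + s *: v + t *: w)) ->
  (forall y, U y -> differentiable f y) ->
  (forall y, U y -> differentiable ('D_v f : V -> R^o) y) ->
  exists s t, [/\ s \in `[0, h]%R, t \in `[0, h]%R &
    f (x + h *: v + h *: w) - f (x + h *: v) - (f (x + h *: w) - f x) =
    'D_w ('D_v f : V -> R^o) (x + s *: v + t *: w) * h * h].
Proof.
move=> h0 inU df ddf.
have h0in : 0 \in `[0, h]%R by rewrite in_itv /= lexx.
have hhin : h \in `[0, h]%R by rewrite in_itv /= lexx h0.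
pose psi : V -> R^o := (f \o +%R (h *: w)) - f.
have dshift (y : V) : is_diff y (+%R (h *: w)) id.
  apply: (is_diff_eq (is_diffD (is_diff_cst (h *: w) y) (is_diff_id y))).
  by rewrite add0r.
have Ut t : t \in `[0, h]%R -> U (x + t *: v).
  by move=> th; have := inU t 0 th h0in; rewrite scale0r addr0.
have Uht t : t \in `[0, h]%R -> U (h *: w + (x + t *: v)).
  by move=> th; rewrite addrC; apply: inU.
have dfh t : t \in `[0, h]%R -> differentiable (f \o +%R (h *: w)) (x + t *: v).
  move=> th; apply: differentiable_comp; first exact: ex_diff.
  by apply: df; exact: Uht.
have dpsi t : t \in `[0, h]%R -> differentiable psi (x + t *: v).
  by move=> th; apply: differentiableB; [exact: dfh|apply: df; exact: Ut].
have [s sh] := MVT_line h0 dpsi.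
have -> : 'D_v psi (x + s *: v) =
    'D_v f (x + s *: v + h *: w) - 'D_v f (x + s *: v).
  rewrite /psi deriveB; [|exact/diff_derivable/dfh|exact/diff_derivable/df/Ut].
  rewrite derive_comp; [|exact: ex_diff|exact/df/Uht].
  have -> : 'D_v (+%R (h *: w)) (x + s *: v) = v.
    by rewrite deriveE ?diff_val.
  by rewrite [h *: w + _]addrC.
have [t th] := MVT_line h0 (fun t th => ddf _ (inU s t sh th)).
rewrite !scale0r !addr0 !subr0 => -> E; exists s, t; split=> //.
by rewrite -E /psi !fctE /= [h *: w + _]addrC [h *: w + x]addrC.
Qed.

Lemma continuous_ball2 (A B : V -> R^o) (U : set V) x (e : R) :
  open U -> U x -> {for x, continuous A} -> {for x, continuous B} -> 0 < e ->
  exists2 r, 0 < r & forall y, ball x r y ->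
    [/\ U y, `|A x - A y| < e & `|B x - B y| < e].
Proof.
move=> oU Ux /cvgrPdist_lt cA /cvgrPdist_lt cB e0.
have UN : nbhs x U by exact: open_nbhs_nbhs.
have /nbhs_ballP[r r0 rP] : nbhs x (U `&` ([set y | `|A x - A y| < e] `&`
    [set y | `|B x - B y| < e])).
  by apply: filterI => //; apply: filterI; [exact: cA|exact: cB].
by exists r => // y /rP[? []].
Qed.

Let box (x v w : V) (h : R) (U : set V) := forall s t : R,
  s \in `[0, h]%R -> t \in `[0, h]%R -> U (x + s *: v + t *: w).

Lemma small_box (x v w : V) (r : R) : 0 < r ->
  exists2 h, 0 < h & box x v w h (ball x r).
Proof.
(* The summand 1 keeps [M] positive when [v] and [w] vanish; the factor 2 in [h] gives
   [h * M = r / 2], strictly below [r]. *)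
move=> r0; pose M := `|v| + `|w| + 1.
have M0 : 0 < M by rewrite ltr_wpDl // addr_ge0.
pose h := r / (2 * M).
have h0 : 0 < h by rewrite divr_gt0 // mulr_gt0.
exists h => // s t; rewrite !in_itv /= => /andP[s0 sh] /andP[t0 th].
rewrite -ball_normE /= -addrA opprD addNKr normrN.
apply: (@le_lt_trans _ _ (h * M)); last first.
  by rewrite /h invfM mulrA divfK ?gt_eqF // ltr_pdivrMr // ltr_pMr // ltr1n.
rewrite /M mulrDr mulr1 mulrDr -[leLHS]addr0 lerD // ?(ltW h0) //.
by rewrite (le_trans (ler_normD _ _)) // lerD // normrZ ger0_norm // ler_wpM2r.
Qed.

(** [A] and [B] stand for the two mixed derivatives. The second difference is symmetric in [v] and
    [w], so a value of [A] equals a value of [B] at two points of an arbitrarily small box, and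
    continuity at [x] does the rest. *)
Lemma second_difference_unique f (U : set V) (x v w : V) (A B : V -> R^o) :
  open U -> U x -> {for x, continuous A} -> {for x, continuous B} ->
  (forall h, 0 <= h -> box x v w h U -> exists s t,
    [/\ s \in `[0, h]%R, t \in `[0, h]%R &
    f (x + h *: v + h *: w) - f (x + h *: v) - (f (x + h *: w) - f x) =
    A (x + s *: v + t *: w) * h * h]) ->
  (forall h, 0 <= h -> box x w v h U -> exists s t,
    [/\ s \in `[0, h]%R, t \in `[0, h]%R &
    f (x + h *: w + h *: v) - f (x + h *: w) - (f (x + h *: v) - f x) =
    B (x + s *: w + t *: v) * h * h]) ->
  A x = B x.
Proof.
move=> oU Ux cA cB dA dB; apply/eqP; rewrite -subr_eq0 -normr_le0.
apply/ler_addgt0Pl => e e0; rewrite addr0.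
have e2 : 0 < e / 2 by rewrite divr_gt0.
have [r r0 rP] := continuous_ball2 oU Ux cA cB e2.
have [h h0 hbox] := small_box x v w r0.
have hbox' : box x w v h (ball x r) by move=> s t ? ?; rewrite addrAC; exact: hbox.
have bU : ball x r `<=` U by move=> y /rP[].
have [s [t [sh th E1]]] := dA h (ltW h0) (fun s t sh th => bU _ (hbox s t sh th)).
have [s' [t' [sh' th' E2]]] :=
  dB h (ltW h0) (fun s t sh th => bU _ (hbox' s t sh th)).
have [_ + _] := rP _ (hbox s t sh th).
have [_ _] := rP _ (hbox' s' t' sh' th').
have -> : A (x + s *: v + t *: w) = B (x + s' *: w + t' *: v).
  have hn0 : h != 0 := lt0r_neq0 h0.
  apply: (@mulIf R h hn0); apply: (@mulIf R h hn0).
  (* After cancelling [h] twice, the symmetry of the second difference remains. *)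
  rewrite -E1 -E2 [x + h *: w + _]addrAC !opprD !opprK !addrA.
  by congr (_ + _); exact: addrAC.
move=> D2 D1.
rewrite -(subrKA (B (x + s' *: w + t' *: v))) (le_trans (ler_normD _ _)) //.
by rewrite [leRHS]splitr lerD // ltW // distrC.
Qed.

Lemma clairaut f (U : set V) (x v w : V) : open U -> U x ->
  (forall y, U y -> differentiable f y) ->
  (forall z y, U y -> differentiable ('D_z f : V -> R^o) y) ->
  (forall z z', {for x, continuous ('D_z' ('D_z f : V -> R^o))}) ->
  'D_w ('D_v f : V -> R^o) x = 'D_v ('D_w f : V -> R^o) x.
Proof.
move=> oU Ux df ddf cf.
apply: (second_difference_unique (f := f) (v := v) (w := w) oU Ux
  (cf v w) (cf w v)) => h h0 hU.
  exact: (second_difference h0 hU df (ddf v)).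
exact: (second_difference h0 hU df (ddf w)).
Qed.

End MeanValue.

(** * Smooth functions between normed spaces *)

Section CkTheory.
Context {R : realType} {V : normedModType R}.

Lemma Ck_eq (W : normedModType R) k (U : set V) (f g : V -> W) : open U ->
  (forall x, U x -> f x = g x) -> Ck k U f -> Ck k U g.
Proof.
move=> oU; elim: k f g => [|k IH] f g fg /=.
  move=> cf x Ux; rewrite /prop_for /continuous_at -(fg x Ux).
  apply: cvg_trans (cf x Ux); apply: near_eq_cvg.
  by apply: filterS (open_nbhs_nbhs (conj oU Ux)) => y /fg.
have nfg x : U x -> \near x, f x = g x.
  by move=> Ux; apply: filterS (open_nbhs_nbhs (conj oU Ux)) => y /fg.
move=> [df dvf]; split=> [x Ux|v].
  exact: near_eq_differentiable (nfg x Ux) (df x Ux).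
by apply: IH (dvf v) => x Ux; apply: near_eq_derive; exact: nfg.
Qed.

Lemma Ck_sub (W : normedModType R) k (U U' : set V) (f : V -> W) : U' `<=` U ->
  Ck k U f -> Ck k U' f.
Proof.
move=> UU; elim: k f => [|k IH] f /=; first by move=> cf x /UU; exact: cf.
by move=> [df dvf]; split=> [x /UU|v]; [exact: df|exact: IH (dvf v)].
Qed.

Lemma Ck_continuous (W : normedModType R) k (U : set V) (f : V -> W) :
  Ck k U f -> forall x, U x -> {for x, continuous f}.
Proof.
case: k => [//|k] /= [df _] x Ux.
by apply: differentiable_continuous; exact: df.
Qed.

Lemma Ck_pred (W : normedModType R) k (U : set V) (f : V -> W) :
  Ck k.+1 U f -> Ck k U f.
Proof.
elim: k f => [|k IH] f; first exact: Ck_continuous.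
by move=> [df dvf]; split=> // v; apply: IH; exact: dvf.
Qed.

Lemma Ck_cst (W : normedModType R) k (U : set V) (c : W) : Ck k U (cst c).
Proof.
elim: k c => [|k IH] c /=; first by move=> x _; exact: cst_continuous.
split=> [x _|v]; first exact: differentiable_cst.
rewrite (_ : (fun x => 'D_v (cst c) x) = cst 0); first exact: IH.
by apply/funext => x; rewrite derive_cst.
Qed.

Lemma CkD (W : normedModType R) k (U : set V) (f g : V -> W) : open U ->
  Ck k U f -> Ck k U g -> Ck k U (f + g).
Proof.
move=> oU; elim: k f g => [|k IH] f g /=.
  by move=> cf cg x Ux; apply: continuousD; [exact: cf|exact: cg].
move=> [df dvf] [dg dvg]; split=> [x Ux|v].
  by apply: differentiableD; [exact: df|exact: dg].
apply: (Ck_eq oU _ (IH _ _ (dvf v) (dvg v))) => x Ux.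
by rewrite deriveD //; apply: diff_derivable; [exact: df|exact: dg].
Qed.

Lemma CkM k (U : set V) (f g : V -> R^o) : open U ->
  Ck k U f -> Ck k U g -> Ck k U (f * g : V -> R^o).
Proof.
move=> oU; elim: k f g => [|k IH] f g.
  move=> cf cg x Ux; apply: (@continuousM R V f g).
    exact: cf.
  exact: cg.
move=> cf cg; have [df dvf] := cf; have [dg dvg] := cg; split=> [x Ux|v].
  by apply: (@differentiableM R V f g); [exact: df|exact: dg].
have H := CkD oU (IH _ _ (Ck_pred cf) (dvg v)) (IH _ _ (Ck_pred cg) (dvf v)).
apply: (Ck_eq oU _ H) => x Ux.
by rewrite (@deriveM R V f g) //; apply: diff_derivable; [exact: df|exact: dg].
Qed.

Lemma Ck_comp_linear (W W' : normedModType R) (l : {linear W -> W'}) k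
    (U : set V) (f : V -> W) : open U -> continuous l ->
  Ck k U f -> Ck k U (l \o f).
Proof.
move=> oU cl; elim: k f => [|k IH] f /=.
  by move=> cf x Ux; apply: continuous_comp; [exact: cf|exact: cl].
move=> [df dvf]; split=> [x Ux|v].
  by apply: differentiable_comp; [exact: df|exact: linear_differentiable].
apply: (Ck_eq oU _ (IH _ (dvf v))) => x Ux /=.
have dl y : differentiable l y by exact: linear_differentiable.
by rewrite derive_comp //; [rewrite [RHS]deriveE // diff_lin|exact: df].
Qed.

End CkTheory.

(** The differential of [a] is the same map [l] at every point, so ['D_v (f \o a)] is again a
    derivative of [f] in a fixed direction composed with [a], and the induction closes. It serves
    for the slices of the group law. *)
Lemma Ck_precomp (R : realType) (V V' W : normedModType R) (a l : V' -> V) k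
    (U : set V) (f : V -> W) : open U ->
  (forall x, is_diff x a l) -> Ck k U f -> Ck k (a @^-1` U) (f \o a).
Proof.
move=> oU da; have da' x : differentiable a x by exact: ex_diff.
elim: k f => [|k IH] f /=.
  move=> cf x Ux; apply: continuous_comp; last exact: cf.
  exact: differentiable_continuous.
move=> [df dvf]; split=> [x Ux|v].
  by apply: differentiable_comp => //; exact: df.
have oU' : open (a @^-1` U).
  apply: open_comp => // x _; exact: differentiable_continuous.
apply: (Ck_eq oU' _ (IH _ (dvf (l v)))) => x Ux /=.
have dav : 'D_v a x = l v by rewrite deriveE // diff_val.
by rewrite derive_comp ?dav //; exact: df.
Qed.

Section RowValued.
Context {R : realType} {n : nat}.

Definition rcoord (j : 'I_n) (v : 'rV[R]_n) : R^o := v 0 j.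

Fact rcoord_is_linear j : linear (rcoord j).
Proof. by move=> a u v; rewrite /rcoord !mxE. Qed.

HB.instance Definition _ j :=
  GRing.isLinear.Build R 'rV[R]_n R^o _ (rcoord j) (rcoord_is_linear j).

Lemma rcoord_continuous j : continuous (rcoord j).
Proof. exact: coord_continuous. Qed.

Lemma rcoord_differentiable j v : differentiable (rcoord j) v.
Proof. exact/linear_differentiable/rcoord_continuous. Qed.

Context {V : normedModType R}.

Lemma derive_rcoord (F : V -> 'rV[R]_n) x v j : differentiable F x ->
  'D_v (rcoord j \o F) x = ('D_v F x) 0 j.
Proof.
move=> dF; rewrite derive_comp //; last exact: rcoord_differentiable.
rewrite [LHS]deriveE; last exact: rcoord_differentiable.
by rewrite (diff_lin _ (@rcoord_continuous j)).
Qed.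

Lemma clairaut_row (F : V -> 'rV[R]_n) (U : set V) x v w : open U -> U x ->
  Ck 2 U F -> 'D_w ('D_v F) x = 'D_v ('D_w F) x.
Proof.
move=> oU Ux CF; have [dF ddF] := CF; apply/rowP => j.
have [CFj Uj] : Ck 2 U (rcoord j \o F) /\ forall v y, U y ->
    'D_v (rcoord j \o F) y = (rcoord j \o 'D_v F) y.
  split; first exact: Ck_comp_linear (@rcoord_continuous j) CF.
  by move=> ? y Uy; rewrite derive_rcoord //; exact: dF.
have E z : \near x, ('D_z (rcoord j \o F) : V -> R^o) x = (rcoord j \o 'D_z F) x.
  by apply: filterS (open_nbhs_nbhs (conj oU Ux)) => y; exact: Uj.
have E2 y z : ('D_y ('D_z F) x) 0 j = 'D_y ('D_z (rcoord j \o F) : V -> R^o) x.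
  rewrite -(derive_rcoord y j ((ddF z).1 x Ux)).
  exact/esym/near_eq_derive/E.
refine (etrans (E2 w v) (etrans _ (esym (E2 v w)))).
have CFj1 z y : U y -> differentiable ('D_z (rcoord j \o F) : V -> R^o) y.
  exact: (CFj.2 z).1.
have CFj2 z z' : {for x, continuous ('D_z' ('D_z (rcoord j \o F) : V -> R^o))}.
  exact: ((CFj.2 z).2 z').
exact: (clairaut v w oU Ux CFj.1 CFj1 CFj2).
Qed.

Lemma derive_scale (f : V -> R^o) (F : V -> 'rV[R]_n) x v :
  differentiable f x -> differentiable F x ->
  derivable (fun y => f y *: F y) x v /\
  'D_v (fun y => f y *: F y) x = 'D_v f x *: F x + f x *: 'D_v F x.
Proof.
move=> df dF; have dFj j : differentiable (rcoord j \o F) x.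
  by apply: differentiable_comp => //; exact: rcoord_differentiable.
have E (i : 'I_1) j : (fun y => (f y *: F y) i j) = (f * (rcoord j \o F) : V -> R).
  by apply/funext => y; rewrite (ord1 i) mxE.
have D : derivable (fun y => f y *: F y) x v.
  apply/derivable_mxP => i j; rewrite E.
  by apply: derivableM; exact: diff_derivable.
split=> //; rewrite derive_mx //; apply/rowP => j.
rewrite mxE E (@deriveM R V f); [|exact: diff_derivable|exact: diff_derivable].
rewrite (derive_rcoord v j dF) !mxE addrC; congr (_ + _).
by rewrite /= /rcoord mulrC.
Qed.

End RowValued.

Lemma derive_row_sum (R : realType) n m (L : 'rV[R]_n -> 'rV[R]_m) x v :
  differentiable L x ->
  'D_v L x = \sum_k v 0 k *: 'D_(delta_mx 0 k) L x.
Proof.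
move=> dL; rewrite deriveE // {1}(row_sum_delta v) linear_sum.
by apply: eq_bigr => k _; rewrite linearZ deriveE.
Qed.

(* Stated for abstract terms: rewriting with equations between derivatives makes
   unification unfold limits. *)
Lemma sum_split (W : nmodType) n (F F' : 'I_n -> W) a b c :
  a = \sum_k (F k + F' k) -> b = \sum_k F k -> c = \sum_k F' k -> a = b + c.
Proof. by move=> -> -> ->; rewrite big_split. Qed.

(** The direction moves with the point. Expanding it in the standard basis turns ['D_(Y q) L q] into
    a sum of products of functions, to which the product rule applies. *)
Lemma derive_along_field (R : realType) n m (L : 'rV[R]_n -> 'rV[R]_m)
    (Y : 'rV[R]_n -> 'rV[R]_n) (U : set 'rV[R]_n) x v : open U -> U x ->
  Ck 2 U L -> differentiable Y x ->
  'D_v (fun q => 'D_(Y q) L q) x =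
  'D_('D_v Y x) L x + 'D_v ('D_(Y x) L) x.
Proof.
move=> oU Ux CL dY; have [dL dvL] := CL.
have dYk k : differentiable (rcoord k \o Y) x.
  by apply: differentiable_comp => //; exact: rcoord_differentiable.
have E (Z : 'rV[R]_n -> 'rV[R]_n) : \forall q \near x, 'D_(Z q) L q =
    (\sum_k (fun q => (rcoord k \o Z) q *: 'D_(delta_mx 0 k) L q)) q.
  apply: filterS (open_nbhs_nbhs (conj oU Ux)) => q Uq.
  by rewrite fct_sumE derive_row_sum //; exact: dL.
have S k (f : 'rV[R]_n -> R^o) (df : differentiable f x) :=
  derive_scale v df ((dvL (delta_mx 0 k)).1 x Ux).
have dc (c : R^o) : differentiable (cst c : 'rV[R]_n -> R^o) x.
  exact: differentiable_cst.
have E1 : 'D_v (fun q => 'D_(Y q) L q) x = \sum_k ((('D_v Y x) 0 k) *: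
    'D_(delta_mx 0 k) L x + Y x 0 k *: 'D_v ('D_(delta_mx 0 k) L) x).
  refine (etrans (near_eq_derive v (E Y)) _).
  rewrite derive_sum; last by move=> k; exact: (S k _ (dYk k)).1.
  apply: eq_bigr => k _; rewrite (S k _ (dYk k)).2.
  by rewrite (derive_rcoord v k dY).
have E2 : 'D_v ('D_(Y x) L) x = \sum_k Y x 0 k *: 'D_v ('D_(delta_mx 0 k) L) x.
  refine (etrans (near_eq_derive v (E (cst (Y x)))) _).
  rewrite derive_sum; last by move=> k; exact: (S k _ (dc (Y x 0 k))).1.
  apply: eq_bigr => k _; rewrite (S k _ (dc (Y x 0 k))).2.
  by rewrite derive_cst scale0r add0r.
exact: sum_split E1 (derive_row_sum _ (dL _ Ux)) E2.
Qed.

(** * Tensors *)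

Section PushTensor.
Context {R : realType} {n : nat}.
Implicit Types (p q : nat) (A B : 'M[R]_n).

(* The tensor product of the endomorphisms of R^n given by the matrices [W l]. *)
Definition pushF p (W : 'I_p -> 'M[R]_n) (K : tensor R n p) : tensor R n p :=
  [ffun i : {ffun 'I_p -> 'I_n} => \sum_(j : {ffun 'I_p -> 'I_n})
     K j * \prod_(k < p) W k (j k) (i k)].

(** Vectors are rows, so matrices act on the right: in [pushM_comp] the factor applied first stands
    on the left. *)
Definition pushM p A (K : tensor R n p) : tensor R n p := pushF (fun=> A) K.

(* The derivation of the tensor algebra extending the endomorphism [B]. *)
Definition derM p B (K : tensor R n p) : tensor R n p :=
  \sum_(k < p) pushF (fun l => if l == k then B else 1%:M) K.

Lemma push_tensorE p (f : 'rV[R]_n -> 'rV[R]_n) (K : tensor R n p) :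
  push_tensor f K = pushM (lin1_mx f) K.
Proof.
apply/ffunP => i; rewrite !ffunE; apply: eq_bigr => j _; congr (_ * _).
by apply: eq_bigr => k _; rewrite mxE.
Qed.

Lemma pushF_is_linear p (W : 'I_p -> 'M[R]_n) : linear (pushF W).
Proof.
move=> c K L; apply/ffunP => i; rewrite !ffunE scaler_sumr -big_split /=.
by apply: eq_bigr => j _; rewrite !ffunE mulrDl scalerAl.
Qed.

HB.instance Definition _ p (W : 'I_p -> 'M[R]_n) :=
  GRing.isLinear.Build R (tensor R n p) (tensor R n p) _ (pushF W)
    (pushF_is_linear W).

Lemma pushM_is_linear p A : linear (@pushM p A).
Proof. exact: pushF_is_linear. Qed.

HB.instance Definition _ p A :=
  GRing.isLinear.Build R (tensor R n p) (tensor R n p) _ (@pushM p A)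
    (pushM_is_linear A).

Lemma derM_is_linear p B : linear (@derM p B).
Proof.
move=> c K L; rewrite /derM scaler_sumr -big_split /=.
by apply: eq_bigr => k _; rewrite linearP.
Qed.

HB.instance Definition _ p B :=
  GRing.isLinear.Build R (tensor R n p) (tensor R n p) _ (@derM p B)
    (derM_is_linear B).

Lemma pushF_comp p (W W' : 'I_p -> 'M[R]_n) (K : tensor R n p) :
  pushF W' (pushF W K) = pushF (fun l => W l *m W' l) K.
Proof.
apply/ffunP => i; rewrite !ffunE.
transitivity (\sum_(j : {ffun 'I_p -> 'I_n}) \sum_(l : {ffun 'I_p -> 'I_n})
    K l * \prod_k (W k (l k) (j k) * W' k (j k) (i k))).
  apply: eq_bigr => j _; rewrite ffunE mulr_suml; apply: eq_bigr => l _.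
  by rewrite -mulrA big_split.
rewrite exchange_big /=; apply: eq_bigr => l _; rewrite -mulr_sumr.
congr (_ * _).
rewrite -(bigA_distr_bigA (fun k m => W k (l k) m * W' k m (i k))).
by apply: eq_bigr => k _; rewrite mxE.
Qed.

Lemma prod_eq_ffun p (i j : {ffun 'I_p -> 'I_n}) :
  \prod_(k < p) (i k == j k)%:R = (i == j)%:R :> R.
Proof.
have [<-|] := eqVneq i j; first by rewrite big1 // => k _; rewrite eqxx.
move=> ij; have /existsP[k ik] : [exists k, i k != j k].
  rewrite -negb_forall; apply: contra ij => /forallP E.
  by apply/eqP/ffunP => k; exact/eqP/E.
by rewrite (bigD1 k) //= (negbTE ik) mul0r.
Qed.

Lemma pushM1 p (K : tensor R n p) : pushM 1%:M K = K.
Proof.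
apply/ffunP => i; rewrite ffunE.
under eq_bigr => j _ do under eq_bigr => k _ do rewrite mxE.
under eq_bigr => j _ do rewrite prod_eq_ffun.
rewrite (bigD1 i) //= eqxx mulr1 big1 ?addr0 // => j ji.
by rewrite (negbTE ji) mulr0.
Qed.

Lemma pushM_comp p A B (K : tensor R n p) :
  pushM B (pushM A K) = pushM (A *m B) K.
Proof. exact: pushF_comp. Qed.

(** The sum over slots is kept because the Leibniz rules [conn_pure] and [vfield_app_prod] produce
    this shape. Here [B] acts before [A]; in [derM_pushM] it acts after. *)
Lemma pushM_derM p B (K : tensor R n p) A :
  pushM A (derM B K) =
  \sum_(k < p) pushF (fun l => if l == k then B *m A else A) K.
Proof.
rewrite /derM linear_sum; apply: eq_bigr => k _ /=.
rewrite /pushM pushF_comp; congr (pushF _ K); apply/funext => l.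
by case: eqP => // _; rewrite mul1mx.
Qed.

Lemma derM_pushM p A B (K : tensor R n p) : derM B (pushM A K) =
  \sum_(k < p) pushF (fun l => if l == k then A *m B else A) K.
Proof.
apply: eq_bigr => k _.
rewrite /pushM pushF_comp; congr (pushF _ K); apply/funext => l.
by case: eqP => // _; rewrite mulmx1.
Qed.

Lemma pushF_pure p (W : 'I_p -> 'M[R]_n) (v : 'I_p -> 'rV[R]_n) :
  pushF W (pure_tensor v) = pure_tensor (fun k => v k *m W k).
Proof.
apply/ffunP => i; rewrite !ffunE.
under eq_bigr => j _ do rewrite ffunE -big_split /=.
rewrite -(bigA_distr_bigA (fun k m => v k 0 m * W k m (i k))).
by apply: eq_bigr => k _; rewrite mxE.
Qed.

(** Expansion of [K] in the basis tensors; row [m] of a matrix is the image of the basis vector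
    [m]. *)
Lemma pushF_rows p (W : 'I_p -> 'M[R]_n) (K : tensor R n p) :
  pushF W K = \sum_j K j *: pure_tensor (fun k => row (j k) (W k)).
Proof.
apply/ffunP => i; rewrite sum_ffunE ffunE; apply: eq_bigr => j _.
rewrite !ffunE; congr (_ * _).
by apply: eq_bigr => k _; rewrite mxE.
Qed.

Lemma pushM_vec A (v : 'rV[R]_n) : pushM A (vec_tensor v) = vec_tensor (v *m A).
Proof.
have E (w : 'rV[R]_n) : vec_tensor w = pure_tensor (fun _ : 'I_1 => w).
  by apply/ffunP => i; rewrite !ffunE big_ord_recl big_ord0 mulr1.
by rewrite !E /pushM pushF_pure.
Qed.

Lemma pushM_sym_prod p A (v : 'I_p -> 'rV[R]_n) :
  pushM A (sym_prod v) = sym_prod (fun k => v k *m A).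
Proof.
by rewrite /sym_prod linear_sum; apply: eq_bigr => s _; rewrite /= /pushM pushF_pure.
Qed.

Definition ffun_cat p q (i : {ffun 'I_p -> 'I_n} * {ffun 'I_q -> 'I_n}) :
    {ffun 'I_(p + q) -> 'I_n} :=
  [ffun k => match fintype.split k with inl l => i.1 l | inr r => i.2 r end].

Lemma ffun_catl p q i (k : 'I_p) : @ffun_cat p q i (lshift q k) = i.1 k.
Proof. by rewrite ffunE (unsplitK (inl k)). Qed.

Lemma ffun_catr p q i (k : 'I_q) : @ffun_cat p q i (rshift p k) = i.2 k.
Proof. by rewrite ffunE (unsplitK (inr k)). Qed.

Lemma ffun_cat_bij p q : bijective (@ffun_cat p q).
Proof.
exists (fun i : {ffun 'I_(p + q) -> 'I_n} =>
  ([ffun k => i (lshift q k)], [ffun k => i (rshift p k)])).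
  move=> [i j]; congr (_, _); apply/ffunP => k; rewrite ffunE.
    exact: ffun_catl.
  exact: ffun_catr.
move=> i; apply/ffunP => k; rewrite ffunE; case: fintype.splitP => l kl;
rewrite ffunE;
by congr (i _); apply: val_inj.
Qed.

Lemma pushM_mul p q A (K : tensor R n p) (L : tensor R n q) :
  pushM A (tensor_mul K L) = tensor_mul (pushM A K) (pushM A L).
Proof.
apply/ffunP => i; rewrite !ffunE.
rewrite (reindex (@ffun_cat p q)) /=; last exact/onW_bij/ffun_cat_bij.
rewrite big_distrlr pair_big /=; apply: eq_bigr => -[j1 j2] _ /=.
rewrite !ffunE big_split_ord /= mulrACA; congr (_ * _ * (_ * _)).
- by congr (K _); apply/ffunP => k; rewrite ffunE ffun_catl.
- by apply: eq_bigr => k _; rewrite ffun_catl ffunE.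
- by congr (L _); apply/ffunP => k; rewrite ffunE ffun_catr.
- by apply: eq_bigr => k _; rewrite ffun_catr ffunE.
Qed.

Lemma perm_tensor_is_linear p s : linear (@perm_tensor R n p s).
Proof. by move=> c K L; apply/ffunP => i; rewrite !ffunE. Qed.

HB.instance Definition _ p s :=
  GRing.isLinear.Build R (tensor R n p) (tensor R n p) _ (@perm_tensor R n p s)
    (@perm_tensor_is_linear p s).

Lemma perm_tensor_pushF p (s : 'S_p) (W : 'I_p -> 'M[R]_n) (K : tensor R n p) :
  perm_tensor s (pushF W K) = pushF (fun l => W ((s^-1)%g l)) (perm_tensor s K).
Proof.
pose f (j : {ffun 'I_p -> 'I_n}) : {ffun 'I_p -> 'I_n} := [ffun k => j (s k)].
have fb : bijective f.
  exists (fun j : {ffun 'I_p -> 'I_n} => [ffun k => j ((s^-1)%g k)]) => j;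
  by apply/ffunP => k; rewrite !ffunE ?permKV ?permK.
apply/ffunP => i; rewrite !ffunE (reindex f) /=; last exact: onW_bij.
apply: eq_bigr => j _; rewrite ffunE; congr (_ * _).
rewrite (reindex_inj (@perm_inj _ (s^-1)%g)) /=.
by apply: eq_bigr => k _; rewrite !ffunE permKV.
Qed.

Lemma pushM_sym_mul p q A (K : tensor R n p) (L : tensor R n q) :
  pushM A (sym_mul K L) = sym_mul (pushM A K) (pushM A L).
Proof.
rewrite /sym_mul linearZ linear_sum /=; congr (_ *: _); apply: eq_bigr => s _.
by rewrite -pushM_mul /pushM perm_tensor_pushF.
Qed.

(** Equivalent to [is_sym] by [symmetric_is_sym] and [symmetric_decomp], but visibly stable under
    [pushM] and [derM]. *)
Definition symmetric_tensor p (K : tensor R n p) : Prop :=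
  forall s, perm_tensor s K = K.

Lemma symmetric_pushM p A (K : tensor R n p) :
  symmetric_tensor K -> symmetric_tensor (pushM A K).
Proof. by move=> sK s; rewrite /pushM perm_tensor_pushF sK. Qed.

Lemma symmetric_derM p B (K : tensor R n p) :
  symmetric_tensor K -> symmetric_tensor (derM B K).
Proof.
move=> sK s; rewrite /derM linear_sum (reindex_inj (@perm_inj _ (s^-1)%g)) /=.
apply: eq_bigr => k _; rewrite perm_tensor_pushF sK; congr (pushF _ K).
by apply/funext => l; rewrite (inj_eq perm_inj).
Qed.

Lemma perm_pure p (s : 'S_p) (v : 'I_p -> 'rV[R]_n) :
  perm_tensor s (pure_tensor v) = pure_tensor (fun k => v ((s^-1)%g k)).
Proof.
apply/ffunP => i; rewrite !ffunE (reindex_inj (@perm_inj _ (s^-1)%g)) /=.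
by apply: eq_bigr => k _; rewrite ffunE permKV.
Qed.

Lemma symmetric_is_sym p (K : tensor R n p) : Defs.is_sym K -> symmetric_tensor K.
Proof.
move=> [m [c [v ->]]] s; rewrite linear_sum; apply: eq_bigr => j _ /=.
rewrite linearZ; congr (_ *: _); rewrite /sym_prod linear_sum /=.
rewrite [RHS](reindex_inj (@mulgI _ (s^-1)%g)) /=; apply: eq_bigr => t _.
by rewrite perm_pure; congr pure_tensor; apply/funext => k; rewrite permM.
Qed.

(** The sum runs over all multi-indices, not over sorted ones, so that no multiplicities appear.
    These coefficients are those of the final polynomial. *)
Lemma symmetric_decomp p (K : tensor R n p) : symmetric_tensor K ->
  K = \sum_j ((p`!)%:R^-1 * K j) *: sym_prod (fun k => delta_mx 0 (j k)).
Proof.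
move=> sK; have p0 : (p`!)%:R != 0 :> R by rewrite pnatr_eq0 -lt0n fact_gt0.
apply: (scalerI p0).
(* Averaging over inverse permutations makes [perm_pure] yield the very terms of [sym_prod]. *)
transitivity (\sum_(s : 'S_p) perm_tensor (s^-1)%g K).
  by under eq_bigr => s _ do rewrite sK; rewrite sumr_const card_Sn scaler_nat.
rewrite scaler_sumr; under [RHS]eq_bigr => j _ do
  rewrite scalerA mulrA mulfV // mul1r /sym_prod scaler_sumr.
rewrite exchange_big /=; apply: eq_bigr => s _.
rewrite -{1}(pushM1 K) /pushM pushF_rows linear_sum; apply: eq_bigr => j _ /=.
rewrite linearZ /= perm_pure invgK; congr (_ *: pure_tensor _).
by apply/funext => k; rewrite row1.
Qed.

Lemma derMN p A (K : tensor R n p) : derM (- A) K = - derM A K.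
Proof.
rewrite /derM -sumrN; apply: eq_bigr => k _; apply/ffunP => i.
rewrite !ffunE -sumrN; apply: eq_bigr => j _; rewrite -mulrN; congr (_ * _).
rewrite (bigD1 k) //= [in RHS](bigD1 k) //= eqxx mxE -mulNr; congr (_ * _).
by apply: eq_bigr => l /negbTE ->.
Qed.

Lemma derM0 p (K : tensor R n p) : derM 0 K = 0.
Proof.
rewrite /derM big1 // => k _; apply/ffunP => i; rewrite !ffunE big1 // => j _.
by rewrite (bigD1 k) //= eqxx mxE mul0r mulr0.
Qed.

(** On each slot a skew matrix is skew for the inner product of tensors whose orthonormal basis is
    the standard one; hence so is their sum. *)
Lemma derM_skew p B (K : tensor R n p) : B^T = - B ->
  \sum_i K i * derM B K i = 0.
Proof.
move=> Bs; rewrite /derM.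
under eq_bigr => i _ do rewrite sum_ffunE mulr_sumr.
rewrite exchange_big big1 //= => k _.
set W := fun l => if l == k then B else 1%:M.
(* Exchanging the two multi-indices transposes every factor: slot [k] changes sign, the identity
   slots stay. *)
have H : \sum_i K i * pushF W K i = - \sum_i K i * pushF W K i.
  under eq_bigr => i _ do rewrite ffunE mulr_sumr.
  rewrite {1}exchange_big -sumrN /=; apply: eq_bigr => j _.
  rewrite -sumrN; apply: eq_bigr => i _; rewrite mulrCA -mulrN -mulrN.
  congr (_ * (_ * _)); rewrite (bigD1 k) //= [in RHS](bigD1 k) //= -mulNr.
  congr (_ * _); first by rewrite /W eqxx -[in LHS](trmxK B) Bs !mxE.
  by apply: eq_bigr => l /negbTE lk; rewrite /W lk !mxE eq_sym.
have := H; set S := \sum_i _ => {}H.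
have : S *+ 2 = 0 by rewrite mulr2n {1}H addNr.
by move/eqP; rewrite mulrn_eq0 /= => /eqP.
Qed.

(** A permutation carrying one list of indices to the other acts on the slots of [K]. *)
Lemma symmetric_tensor_perm_eq p (K : tensor R n p) (I J : {ffun 'I_p -> 'I_n}) :
  symmetric_tensor K ->
  perm_eq [seq I k | k <- enum 'I_p] [seq J k | k <- enum 'I_p] ->
  K I = K J.
Proof.
move=> sK IJ.
have /tuple_permP[s E] : perm_eq [seq I k | k <- enum 'I_p] [tuple J k | k < p].
  by apply: (perm_trans IJ); rewrite /= enumT.
rewrite -[in RHS](sK s) ffunE; congr (K _); apply/ffunP => k; rewrite ffunE.
have := congr1 (fun t => nth (I k) t k) E.
rewrite (nth_map k) ?size_enum_ord // nth_ord_enum => ->.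
rewrite -[LHS]/(nth (I k) (val [tuple tnth [tuple J k | k < p] (s i) | i < p]) k).
by rewrite -tnth_nth !tnth_mktuple.
Qed.

(** At the multi-index obtained by putting [b] in front of [J], each permutation contributes [K J]
    or 0, and the identity contributes [K J]. The coefficient of the product is thus a positive
    multiple of [K J]; nothing can cancel. *)
Lemma sym_mul_vec_inj p b (K : tensor R n p) : symmetric_tensor K ->
  sym_mul (vec_tensor (delta_mx 0 b)) K = 0 -> K = 0.
Proof.
move=> sK /eqP; rewrite /sym_mul scaler_eq0 invr_eq0 pnatr_eq0 muln_eq0.
rewrite !eqn0Ngt !fact_gt0 /= => /eqP E.
apply/ffunP => J; rewrite [RHS]ffunE.
have [i i0 iJ] : exists2 i : {ffun 'I_(1 + p) -> 'I_n},
    i (lshift p ord0) = b & forall k, i (rshift 1 k) = J k.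
  exists (ffun_cat ([ffun=> b] : {ffun 'I_1 -> 'I_n}, J)) => [|k].
    by rewrite ffun_catl ffunE.
  by rewrite ffun_catr.
pose a (s : 'S_(1 + p)) := i (s (lshift p ord0)) == b.
have Es (s : 'S_(1 + p)) :
    perm_tensor s (tensor_mul (vec_tensor (delta_mx 0 b)) K) i = (a s)%:R * K J.
  rewrite !ffunE /= /a mxE eqxx /=.
 case: eqP => [ib|_]; last by rewrite !mul0r.
  rewrite !mul1r; apply: symmetric_tensor_perm_eq => //.
  (* With the common value [b] restored at the head, the claim is that [i \o s] rearranges [i]. *)
  rewrite -(perm_cons b).
  have H (f : 'I_(1 + p) -> 'I_n) (g : 'I_p -> 'I_n) : f (lshift p ord0) = b ->
      (forall k, f (rshift 1 k) = g k) ->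
      b :: [seq g k | k <- enum 'I_p] = [seq f k | k <- enum 'I_(1 + p)].
    move=> f0 fg; rewrite -f0 [enum 'I_(1 + p)]enum_ordSl /=.
    congr (f _ :: _); first exact: val_inj.
    rewrite -[RHS]map_comp; apply: eq_map => k /=.
    by rewrite -fg; congr (f _); apply: val_inj.
  rewrite (H (i \o s) _ ib); last by move=> k; rewrite !ffunE.
  rewrite (H i J i0); last exact: iJ.
  have -> : [seq (i \o s) k | k <- enum 'I_(1 + p)] =
      map i (map s (enum 'I_(1 + p))) by rewrite -[RHS]map_comp; exact: eq_map.
  apply: perm_map; apply: uniq_perm; rewrite ?enum_uniq //.
    by rewrite map_inj_uniq ?enum_uniq //; exact: perm_inj.
  move=> k; rewrite mem_enum; apply/mapP; exists ((s^-1)%g k).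
    by rewrite mem_enum.
  by rewrite permKV.
have := congr1 (fun T : tensor R n (1 + p) => T i) E.
rewrite sum_ffunE [in RHS]ffunE; under eq_bigr => s _ do rewrite Es.
rewrite -mulr_suml => /eqP; rewrite mulf_eq0 => /orP[|/eqP //].
rewrite -natr_sum pnatr_eq0 sum_nat_eq0 => /forallP/(_ 1%g).
by rewrite /a perm1 i0 eqxx.
Qed.

End PushTensor.

Section TensorProducts.
Context {R : realType} {n : nat}.
Local Notation V := 'rV[R]_n.

Lemma vec_tensorD (v w : V) : vec_tensor (v + w) = vec_tensor v + vec_tensor w.
Proof. by apply/ffunP => i; rewrite !ffunE mxE. Qed.

Lemma vec_tensorZ (c : R) (v : V) : vec_tensor (c *: v) = c *: vec_tensor v.
Proof. by apply/ffunP => i; rewrite !ffunE mxE. Qed.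

Lemma vec_tensor0 : vec_tensor 0 = 0 :> tensor R n 1.
Proof. by apply/ffunP => i; rewrite !ffunE mxE. Qed.

Lemma vec_tensor_sum (I : Type) (r : seq I) (F : I -> V) :
  vec_tensor (\sum_(i <- r) F i) = \sum_(i <- r) vec_tensor (F i).
Proof.
elim: r => [|i r IH]; first by rewrite !big_nil vec_tensor0.
by rewrite !big_cons vec_tensorD IH.
Qed.

Lemma vec_tensorK : cancel (@vec_tensor R n) (@tensor_vec R n).
Proof. by move=> v; apply/rowP => j; rewrite mxE !ffunE. Qed.

Lemma tensor_vecK : cancel (@tensor_vec R n) (@vec_tensor R n).
Proof.
move=> T; apply/ffunP => i; rewrite ffunE mxE; congr (T _).
by apply/ffunP => k; rewrite ffunE (ord1 k).
Qed.

Lemma pure_tensor0 (v : 'I_0 -> V) i : pure_tensor v i = 1.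
Proof. by rewrite ffunE big_ord0. Qed.

(** The degrees [p.+1] and [1 + p] are convertible; this is the step of the inductions on the
    degree. *)
Lemma pure_tensorS p (v : 'I_p.+1 -> V) : pure_tensor v =
  tensor_mul (vec_tensor (v ord0)) (pure_tensor (fun k => v (lift ord0 k)))
  :> tensor R n (1 + p).
Proof.
apply/ffunP => i; rewrite !ffunE big_ord_recl; congr (v _ _ _ * _).
  by congr (i _); apply: val_inj.
by apply: eq_bigr => k _; rewrite ffunE; congr (v _ _ (i _)); apply: val_inj.
Qed.

Lemma tensor_mulDr p q (K : tensor R n p) (L L' : tensor R n q) :
  tensor_mul K (L + L') = tensor_mul K L + tensor_mul K L'.
Proof. by apply/ffunP => i; rewrite !ffunE mulrDr. Qed.

Lemma tensor_mul0r p q (K : tensor R n p) : tensor_mul K (0 : tensor R n q) = 0.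
Proof. by apply/ffunP => i; rewrite !ffunE mulr0. Qed.

Lemma tensor_mul_sumr p q (I : Type) (r : seq I) (K : tensor R n p)
    (F : I -> tensor R n q) :
  tensor_mul K (\sum_(i <- r) F i) = \sum_(i <- r) tensor_mul K (F i).
Proof.
elim: r => [|i r IH]; first by rewrite !big_nil tensor_mul0r.
by rewrite !big_cons tensor_mulDr IH.
Qed.

Lemma tensor_mulDl p q (K K' : tensor R n p) (L : tensor R n q) :
  tensor_mul (K + K') L = tensor_mul K L + tensor_mul K' L.
Proof. by apply/ffunP => i; rewrite !ffunE mulrDl. Qed.

Lemma tensor_mulZl p q (c : R) (K : tensor R n p) (L : tensor R n q) :
  tensor_mul (c *: K) L = c *: tensor_mul K L.
Proof. by apply/ffunP => i; rewrite !ffunE scalerAl. Qed.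

Lemma tensor_mulZr p q (c : R) (K : tensor R n p) (L : tensor R n q) :
  tensor_mul K (c *: L) = c *: tensor_mul K L.
Proof. by apply/ffunP => i; rewrite !ffunE scalerAr. Qed.

Lemma sym_mulDr p q (K : tensor R n p) (L L' : tensor R n q) :
  sym_mul K (L + L') = sym_mul K L + sym_mul K L'.
Proof.
rewrite /sym_mul -scalerDr -big_split /=; congr (_ *: _).
by apply: eq_bigr => s _; rewrite tensor_mulDr linearD.
Qed.

Lemma sym_mulDl p q (K K' : tensor R n p) (L : tensor R n q) :
  sym_mul (K + K') L = sym_mul K L + sym_mul K' L.
Proof.
rewrite /sym_mul -scalerDr -big_split /=; congr (_ *: _).
by apply: eq_bigr => s _; rewrite tensor_mulDl linearD.
Qed.

Lemma sym_mulZl p q (c : R) (K : tensor R n p) (L : tensor R n q) :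
  sym_mul (c *: K) L = c *: sym_mul K L.
Proof.
rewrite /sym_mul scalerA mulrC -scalerA; congr (_ *: _); rewrite scaler_sumr.
by apply: eq_bigr => s _; rewrite tensor_mulZl linearZ.
Qed.

Lemma sym_mulZr p q (c : R) (K : tensor R n p) (L : tensor R n q) :
  sym_mul K (c *: L) = c *: sym_mul K L.
Proof.
rewrite /sym_mul scalerA mulrC -scalerA; congr (_ *: _); rewrite scaler_sumr.
by apply: eq_bigr => s _; rewrite tensor_mulZr linearZ.
Qed.

Lemma sym_mul0r p q (K : tensor R n p) : sym_mul K (0 : tensor R n q) = 0.
Proof. by rewrite -(scale0r (0 : tensor R n q)) sym_mulZr scale0r. Qed.

Lemma sym_mul0l p q (L : tensor R n q) : sym_mul (0 : tensor R n p) L = 0.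
Proof. by rewrite -(scale0r (0 : tensor R n p)) sym_mulZl scale0r. Qed.

Lemma sym_mul_suml p q (I : Type) (r : seq I) (F : I -> tensor R n p)
    (L : tensor R n q) :
  sym_mul (\sum_(i <- r) F i) L = \sum_(i <- r) sym_mul (F i) L.
Proof.
elim: r => [|i r IH]; first by rewrite !big_nil sym_mul0l.
by rewrite !big_cons sym_mulDl IH.
Qed.

Lemma sym_mul_sumr p q (I : Type) (r : seq I) (K : tensor R n p)
    (F : I -> tensor R n q) :
  sym_mul K (\sum_(i <- r) F i) = \sum_(i <- r) sym_mul K (F i).
Proof.
elim: r => [|i r IH]; first by rewrite !big_nil sym_mul0r.
by rewrite !big_cons sym_mulDr IH.
Qed.

Lemma sym_mul_vecC (v w : V) :
  sym_mul (vec_tensor v) (vec_tensor w) = sym_mul (vec_tensor w) (vec_tensor v).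
Proof.
rewrite /sym_mul; congr (_ *: _).
pose t : 'S_(1 + 1) := tperm (lshift 1 ord0) (rshift 1 ord0).
rewrite [RHS](reindex_inj (@mulgI _ t)) /=; apply: eq_bigr => s _.
apply/ffunP => i; rewrite !ffunE mulrC.
by congr (w _ (i _) * v _ (i _)); rewrite permM /t (ord1 ord0) ?tpermL ?tpermR.
Qed.

Lemma push_vec_tensor (A : {linear V -> V}) (v : V) :
  push_tensor A (vec_tensor v) = vec_tensor (A v).
Proof. by rewrite push_tensorE pushM_vec mul_rV_lin1. Qed.

End TensorProducts.

(** * Charts and tangent maps *)

Section Charts.
Context {R : realType} {n : nat} {M : manifoldType R n}.
Implicit Types (a b c u : M) (h k : M -> M).

Definition cod a : set 'rV[R]_n := chart a @` chart_dom a.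

Lemma cod_chart a u : chart_dom a u -> cod a (chart a u).
Proof. by move=> au; exists u. Qed.

Lemma chart_invP a x : cod a x ->
  chart_dom a (chart_inv a x) /\ chart a (chart_inv a x) = x.
Proof. by move=> [u au <-]; rewrite chartK. Qed.

Lemma nbhs_cod a u : chart_dom a u -> nbhs (chart a u) (cod a).
Proof.
by move=> au; apply: open_nbhs_nbhs; split; [exact: chart_cod_open|exact: cod_chart].
Qed.

Lemma nbhs_chart_inv a u (P : set M) : chart_dom a u -> nbhs u P ->
  \forall x \near chart a u, P (chart_inv a x).
Proof.
move=> au uP; have := chart_inv_continuous a _ (cod_chart au).
by rewrite /prop_for /continuous_at chartK //; apply.
Qed.

Lemma nbhs_chart_dom a u : chart_dom a u -> nbhs u (chart_dom a).
Proof. by move=> au; apply: open_nbhs_nbhs; split => //; exact: chart_dom_open. Qed.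

(** Tangent maps and changes of coordinates are both of this form, so the single chain rule
    [mder_comp] handles all of them. *)
Definition mder h a b u : 'rV[R]_n -> 'rV[R]_n :=
  'd (chart b \o h \o chart_inv a) (chart a u).

(** All pairs of charts are quantified over, which makes independence of the chart part of the
    notion. Continuity keeps nearby points inside the target chart. *)
Definition mdiff h u : Prop := {for u, continuous h} /\
  forall a b, chart_dom a u -> chart_dom b (h u) ->
    differentiable (chart b \o h \o chart_inv a) (chart a u).

Lemma tangent_mapE h u : tangent_map h u = mder h u (h u) u.
Proof. by []. Qed.

Lemma coord_changeE a u : coord_change a u = mder id u a u.
Proof. by []. Qed.

(** The intermediate chart [b] can be inserted only near [u], where continuity of [k] keeps the
    values in its domain. *)
Lemma mder_comp h k a b c u v : mdiff k u -> mdiff h (k u) ->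
  chart_dom a u -> chart_dom b (k u) -> chart_dom c (h (k u)) ->
  mder (h \o k) a c u v = mder h b c (k u) (mder k a b u v).
Proof.
move=> [ck dk] [ch dh] au bku chku; rewrite /mder.
have dk1 := dk a b au bku; have dh1 := dh b c bku chku.
pose K := chart b \o k \o chart_inv a; pose H := chart c \o h \o chart_inv b.
have E : chart b (k u) = K (chart a u) by rewrite /K /= chartK.
move: dk1 dh1; rewrite -/K -/H E => dk1 dh1.
have near1 : \forall x \near chart a u, (H \o K) x =
    (chart c \o (h \o k) \o chart_inv a) x.
  have : nbhs u (k @^-1` chart_dom b) by apply: ck; exact: nbhs_chart_dom.
  move=> /(nbhs_chart_inv au); apply: filterS => x /= bx.
  by rewrite /H /K /= chartK.
have dHK : differentiable (H \o K) (chart a u) := differentiable_comp dk1 dh1.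
exact: (etrans (congr1 (fun f => f v) (near_eq_diff near1 dHK))
               (congr1 (fun f => f v) (diff_comp dk1 dh1))).
Qed.

Lemma mdiff_id u : mdiff id u.
Proof.
split=> [//|a b au bu].
by have := (chart_transition_smooth a b 1%N).1; apply; exists u.
Qed.

Lemma mder_id a u v : chart_dom a u -> mder id a a u v = v.
Proof.
move=> au; rewrite /mder.
have near1 : \forall x \near chart a u, id x =
    (chart a \o id \o chart_inv a) x.
  by apply: filterS (nbhs_cod au) => x /chart_invP[].
have [did dval] := is_diff_id (chart a u).
exact: (congr1 (fun f => f v) (etrans (near_eq_diff near1 did) dval)).
Qed.

Lemma coord_change_tangent a h u v : mdiff h u -> chart_dom a (h u) ->
  coord_change a (h u) (tangent_map h u v) = mder h u a u v.
Proof.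
move=> dh ahu; rewrite coord_changeE tangent_mapE.
rewrite -(mder_comp (h := id) (b := h u)) //; try exact: chart_domP.
exact: mdiff_id.
Qed.

End Charts.

(** * Left and right translations in charts *)

Section Translations.
Context {R : realType} {n : nat} {G : lieGroupType R n}.
Local Notation V := 'rV[R]_n.
Implicit Types (a b c u w : G).

(** The group law in charts. Translations are its slices, so their differentials are its partial
    derivatives. *)
Definition mloc a b c (p : V * V) : V :=
  chart c (chart_inv a p.1 * chart_inv b p.2)%g.

Definition mdom a b c : set (V * V) := [set p | [/\ cod a p.1, cod b p.2 &
  chart_dom c (chart_inv a p.1 * chart_inv b p.2)%g]].

Lemma mloc_smooth a b c k : Ck k (mdom a b c) (mloc a b c).
Proof. exact: lie_mul_smooth. Qed.

Lemma mdom_open a b c : open (mdom a b c).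
Proof.
rewrite openE => p [ap bp cp]; rewrite /interior.
have c1 : {for p, continuous (fun q : V * V => chart_inv a q.1)}.
  apply: (@continuous_comp _ _ _ fst (chart_inv a)); first exact: cvg_fst.
  exact: chart_inv_continuous.
have c2 : {for p, continuous (fun q : V * V => chart_inv b q.2)}.
  apply: (@continuous_comp _ _ _ snd (chart_inv b)); first exact: cvg_snd.
  exact: chart_inv_continuous.
have c12 : {for p,
    continuous (fun q : V * V => (chart_inv a q.1 * chart_inv b q.2)%g)}.
  apply: (@continuous_comp _ _ _
    (fun q : V * V => (chart_inv a q.1, chart_inv b q.2))
    (fun q : G * G => (q.1 * q.2)%g)); first exact: cvg_pair.
  exact: lie_mul_continuous.
have N12 : nbhs p (cod a `*` cod b).
  exists (cod a, cod b) => //; split; apply: open_nbhs_nbhs; split=> //;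
  exact: chart_cod_open.
have N3 := c12 _ (open_nbhs_nbhs (conj (chart_dom_open c) cp)).
by apply: filterS2 N12 N3 => q [? ?] ?.
Qed.

Lemma mloc_diff a b c p : mdom a b c p -> differentiable (mloc a b c) p.
Proof. exact: (mloc_smooth a b c 1%N).1. Qed.

Lemma is_diff_pairl (x q : V) : is_diff x (fun y : V => (y, q)) (fun y => (y, 0)).
Proof. exact: (is_diff_pair (is_diff_id x) (is_diff_cst q x)). Qed.

Lemma is_diff_pairr (x q : V) : is_diff x (fun y : V => (q, y)) (fun y => (0, y)).
Proof. exact: (is_diff_pair (is_diff_cst q x) (is_diff_id x)). Qed.

Lemma derive_pairl (F : V * V -> V) x y v : differentiable F (x, y) ->
  differentiable (fun z => F (z, y)) x /\
  'D_v (fun z => F (z, y)) x = 'D_(v, 0) F (x, y).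
Proof.
move=> dF; have [d dv] := is_diff_pairl x y.
have D : 'D_v (fun z : V => (z, y)) x = (v, 0) by rewrite deriveE // dv.
split; first exact: (differentiable_comp d dF).
by rewrite -D; exact: (derive_comp v d dF).
Qed.

Lemma derive_pairr (F : V * V -> V) x y v : differentiable F (x, y) ->
  differentiable (fun z => F (x, z)) y /\
  'D_v (fun z => F (x, z)) y = 'D_(0, v) F (x, y).
Proof.
move=> dF; have [d dv] := is_diff_pairr y x.
have D : 'D_v (fun z : V => (x, z)) y = (0, v) by rewrite deriveE // dv.
split; first exact: (differentiable_comp d dF).
by rewrite -D; exact: (derive_comp v d dF).
Qed.

Lemma ltrans_local a b c u w : chart_dom b u -> chart_dom a w ->
  chart_dom c (u * w)%g ->
  differentiable (chart c \o ltrans u \o chart_inv a) (chart a w) /\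
  forall y, mder (ltrans u) a c w y = 'D_(0, y) (mloc b a c) (chart b u, chart a w).
Proof.
move=> bu aw cuw.
have -> : chart c \o ltrans u \o chart_inv a = (fun q => mloc b a c (chart b u, q)).
  by apply/funext => q; rewrite /mloc /= chartK.
have dm : differentiable (mloc b a c) (chart b u, chart a w).
  by apply: mloc_diff; split; rewrite /= ?chartK //; exact: cod_chart.
split=> [|y]; first by have [] := derive_pairr 0 dm.
rewrite /mder.
have -> : chart c \o ltrans u \o chart_inv a = (fun q => mloc b a c (chart b u, q)).
  by apply/funext => q; rewrite /mloc /= chartK.
have [d1 d2] := derive_pairr y dm.
by rewrite -d2 deriveE.
Qed.

Lemma rtrans_local a b c u w : chart_dom b u -> chart_dom a w ->
  chart_dom c (w * u)%g ->
  differentiable (chart c \o rtrans u \o chart_inv a) (chart a w) /\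
  forall y, mder (rtrans u) a c w y = 'D_(y, 0) (mloc a b c) (chart a w, chart b u).
Proof.
move=> bu aw cuw.
have -> : chart c \o rtrans u \o chart_inv a = (fun q => mloc a b c (q, chart b u)).
  by apply/funext => q; rewrite /mloc /= chartK.
have dm : differentiable (mloc a b c) (chart a w, chart b u).
  by apply: mloc_diff; split; rewrite /= ?chartK //; exact: cod_chart.
split=> [|y]; first by have [] := derive_pairl 0 dm.
rewrite /mder.
have -> : chart c \o rtrans u \o chart_inv a = (fun q => mloc a b c (q, chart b u)).
  by apply/funext => q; rewrite /mloc /= chartK.
have [d1 d2] := derive_pairl y dm.
by rewrite -d2 deriveE.
Qed.

Lemma ltrans_mdiff u w : mdiff (ltrans u) w.
Proof.
split=> [|a b aw buw]; last first.
  by have [] := ltrans_local (chart_domP u) aw buw.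
apply: (@continuous_comp _ _ _ (fun q : G => (u, q))
  (fun q : G * G => (q.1 * q.2)%g)).
  by apply: cvg_pair; [exact: cvg_cst|exact: cvg_id].
exact: lie_mul_continuous.
Qed.

Lemma rtrans_mdiff u w : mdiff (rtrans u) w.
Proof.
split=> [|a b aw buw]; last first.
  by have [] := rtrans_local (chart_domP u) aw buw.
apply: (@continuous_comp _ _ _ (fun q : G => (q, u))
  (fun q : G * G => (q.1 * q.2)%g)).
  by apply: cvg_pair; [exact: cvg_id|exact: cvg_cst].
exact: lie_mul_continuous.
Qed.

End Translations.

(** * Invariant vector fields *)

Section FieldSmoothness.
Context {R : realType} {n : nat} {M : manifoldType R n}.

Lemma smooth_vfieldP (X : M -> 'rV[R]_n) :
  (forall a k, Ck k (cod a) (local_rep a X)) -> smooth_vfield X.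
Proof.
move=> XP a i k.
have E : (fun x : 'rV[R]_n => push_tensor (coord_change a (chart_inv a x))
    (vfield_tensor X (chart_inv a x)) i : R^o) = rcoord (i ord0) \o local_rep a X.
  apply/funext => x; rewrite /vfield_tensor.
  by rewrite (push_vec_tensor ('d (chart a \o chart_inv (chart_inv a x)) _)) ffunE.
rewrite E; apply: Ck_comp_linear (XP a k); first exact: chart_cod_open.
exact: rcoord_continuous.
Qed.

Lemma local_rep_center (X : M -> 'rV[R]_n) u : local_rep u X (chart u u) = X u.
Proof.
rewrite /local_rep chartK; last exact: chart_domP.
by rewrite coord_changeE mder_id //; exact: chart_domP.
Qed.

Lemma lie_bracketC (X Y : M -> 'rV[R]_n) u : lie_bracket X Y u = - lie_bracket Y X u.
Proof. by rewrite /lie_bracket [RHS]opprB. Qed.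

Lemma lie_bracket_self (X : M -> 'rV[R]_n) u : lie_bracket X X u = 0.
Proof. by rewrite /lie_bracket [LHS]subrr. Qed.

End FieldSmoothness.

Section InvariantFields.
Context {R : realType} {n : nat} {G : lieGroupType R n}.
Local Notation V := 'rV[R]_n.
Implicit Types (a b c u w : G) (y z : V).

Definition right_vfield z : G -> V := fun u => tangent_map (rtrans u) 1%g z.

Lemma left_vfieldE y u : left_vfield y u = mder (ltrans u) 1%g u 1%g y.
Proof. by rewrite /left_vfield tangent_mapE {2}/ltrans mulg1. Qed.

Lemma right_vfieldE z u : right_vfield z u = mder (rtrans u) 1%g u 1%g z.
Proof. by rewrite /right_vfield tangent_mapE {2}/rtrans mul1g. Qed.

Lemma tangent_ltrans_left y u w :
  tangent_map (ltrans w) u (left_vfield y u) = left_vfield y (w * u)%g.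
Proof.
have E : ltrans (w * u)%g = ltrans w \o ltrans u.
  by apply/funext => v; rewrite /ltrans /= mulgA.
have Eu : ltrans u 1%g = u by rewrite /ltrans mulg1.
have := @mder_comp R n G (ltrans w) (ltrans u) 1%g u (w * u)%g 1%g y.
rewrite Eu -E tangent_mapE !left_vfieldE => -> //; try exact: chart_domP.
  exact: ltrans_mdiff.
exact: ltrans_mdiff.
Qed.

Lemma left_vfield_left_invariant y : left_invariant_vfield (left_vfield y : G -> V).
Proof.
move=> a u; rewrite /vfield_tensor -tangent_ltrans_left.
exact: (push_vec_tensor ('d (chart (ltrans a u) \o ltrans a \o chart_inv u) _)).
Qed.

Lemma left_vfield1 y : left_vfield y (1%g : G) = y.
Proof.
rewrite left_vfieldE.
have -> : ltrans (1%g : G) = id by apply/funext => v; rewrite /ltrans mul1g.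
by rewrite mder_id //; exact: chart_domP.
Qed.

Lemma right_vfield1 y : right_vfield y (1%g : G) = y.
Proof.
rewrite right_vfieldE.
have -> : rtrans (1%g : G) = id by apply/funext => v; rewrite /rtrans mulg1.
by rewrite mder_id //; exact: chart_domP.
Qed.

Lemma mdom1r a x : cod a x -> mdom a 1%g a (x, chart (1%g : G) 1%g).
Proof.
move=> ax; have [ax1 ax2] := chart_invP ax.
split=> //=; first exact/cod_chart/chart_domP.
by rewrite chartK ?mulg1 //; exact: chart_domP.
Qed.

Lemma mdom1l a x : cod a x -> mdom 1%g a a (chart (1%g : G) 1%g, x).
Proof.
move=> ax; have [ax1 ax2] := chart_invP ax.
split=> //=; first exact/cod_chart/chart_domP.
by rewrite chartK ?mul1g //; exact: chart_domP.
Qed.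

(** At a point u the field is the derivative of u * v in [v] at 1. In a fixed chart it becomes a
    partial derivative of the group law, which yields smoothness in [x]. *)
Lemma left_rep y a x : cod a x -> local_rep a (left_vfield y) x =
  'D_(0, y) (mloc a 1%g a) (x, chart (1%g : G) 1%g).
Proof.
move=> ax; have [ax1 ax2] := chart_invP ax.
rewrite /local_rep; set u := chart_inv a x in ax1 ax2 *.
have Eu : ltrans u 1%g = u by rewrite /ltrans mulg1.
rewrite -{1}Eu coord_change_tangent ?Eu //; last exact: ltrans_mdiff.
have [_ ->] := @ltrans_local R n G 1%g a a u 1%g ax1 (chart_domP _)
  (eq_ind_r _ ax1 (mulg1 u)).
by rewrite ax2.
Qed.

Lemma right_rep z a x : cod a x -> local_rep a (right_vfield z) x =
  'D_(z, 0) (mloc 1%g a a) (chart (1%g : G) 1%g, x).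
Proof.
move=> ax; have [ax1 ax2] := chart_invP ax.
rewrite /local_rep; set u := chart_inv a x in ax1 ax2 *.
have Eu : rtrans u 1%g = u by rewrite /rtrans mul1g.
rewrite -{1}Eu coord_change_tangent ?Eu //; last exact: rtrans_mdiff.
have [_ ->] := @rtrans_local R n G 1%g a a u 1%g ax1 (chart_domP _)
  (eq_ind_r _ ax1 (mul1g u)).
by rewrite ax2.
Qed.

Lemma left_rep_Ck y a k : Ck k (cod a) (local_rep a (left_vfield y : G -> V)).
Proof.
have oc : open (cod a) := chart_cod_open a.
apply: (Ck_eq oc (fun x ax => esym (left_rep y ax))).
have C := Ck_precomp (mdom_open (a := a) (b := 1%g) (c := a))
  (fun x : V => is_diff_pairl x (chart (1%g : G) 1%g))
  (* One order of regularity is spent on the partial derivative. *)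
  ((mloc_smooth a 1%g a k.+1).2 (0, y)).
apply: Ck_sub C => x ax; exact: mdom1r ax.
Qed.

Lemma right_rep_Ck z a k : Ck k (cod a) (local_rep a (right_vfield z : G -> V)).
Proof.
have oc : open (cod a) := chart_cod_open a.
apply: (Ck_eq oc (fun x ax => esym (right_rep z ax))).
have C := Ck_precomp (mdom_open (a := 1%g) (b := a) (c := a))
  (fun x : V => is_diff_pairr x (chart (1%g : G) 1%g))
  ((mloc_smooth 1%g a a k.+1).2 (z, 0)).
apply: Ck_sub C => x ax; exact: mdom1l ax.
Qed.

Lemma left_vfield_smooth y : smooth_vfield (left_vfield y : G -> V).
Proof. by apply: smooth_vfieldP => a k; exact: left_rep_Ck. Qed.

Lemma right_vfield_smooth y : smooth_vfield (right_vfield y).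
Proof. by apply: smooth_vfieldP => a k; exact: right_rep_Ck. Qed.

Section Brackets.
Variable u : G.
Local Notation x0 := (chart u u).
Local Notation q0 := (chart (1%g : G) 1%g).
Local Notation m := (mloc u 1%g u).
(** Left translation by [u], read from the chart at 1 to the chart at [u]; it sends [q0] to [x0]. *)
Let L : V -> V := fun q => m (x0, q).

Let Um : mdom u 1%g u (x0, q0).
Proof. by apply: mdom1r; apply: cod_chart; exact: chart_domP. Qed.

Let mC k : Ck k (mdom u 1%g u) m. Proof. exact: mloc_smooth. Qed.

Let UL : set V := (pair x0) @^-1` mdom u 1%g u.

Let UL_open : open UL.
Proof.
apply: open_comp; last exact: mdom_open.
by move=> q _; apply: differentiable_continuous; have [] := is_diff_pairr q x0.
Qed.

Let ULq0 : UL q0. Proof. exact: Um. Qed.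

Let LC k : Ck k UL L.
Proof. exact: Ck_precomp (mdom_open (a := u) (b := 1%g) (c := u))
  (fun q : V => is_diff_pairr q x0) (mC k). Qed.

Let Lq0 : L q0 = x0.
Proof. by rewrite /L /mloc /= !chartK ?mulg1 //; exact: chart_domP. Qed.

Let ULP q : UL q -> [/\ cod (1%g : G) q,
  chart_dom u (u * chart_inv (1%g : G) q)%g &
  chart_inv u (L q) = (u * chart_inv (1%g : G) q)%g].
Proof.
case=> /= c1 c2; rewrite chartK; last exact: chart_domP.
by move=> cu; split=> //; rewrite /L /mloc /= !chartK //; exact: chart_domP.
Qed.

Let left_L y : left_vfield y u = 'D_y L q0.
Proof.
rewrite -(local_rep_center (left_vfield y : G -> V)).
rewrite (left_rep y (cod_chart (chart_domP u))).
by have [_ ->] := derive_pairr y (mloc_diff Um).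
Qed.

Let codx0 : cod u x0. Proof. exact/cod_chart/chart_domP. Qed.

(** Pulling back by [L] replaces the value of the field at [u] by the fixed direction [y] at the
    unit. *)
Let derive_along_left y (F : V -> V) : differentiable F x0 ->
  'D_(left_vfield y u) F x0 = 'D_y (F \o L) q0.
Proof.
rewrite -Lq0 left_L => dF; apply/esym/derive_comp => //.
exact: (LC 1%N).1.
Qed.

(** The right-invariant field along u * w is the derivative of the group law in its first variable,
    since right translation by u * w factors through [u]; the left-invariant field is a derivative
    in the second variable. The two terms of the bracket are the two mixed second derivatives of
    [m], equal by Clairaut. *)
Lemma bracket_left_right y z :
  lie_bracket (left_vfield y) (right_vfield z) u = 0.
Proof.
rewrite /lie_bracket; apply/eqP; rewrite subr_eq0; apply/eqP.
have dY := (right_rep_Ck z u 1%N).1 _ codx0.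
rewrite (derive_along_left y dY).
set Yu := right_vfield z u.
have E1 : \forall q \near q0, (local_rep u (right_vfield z) \o L) q =
    ('D_(Yu, 0) m \o pair x0) q.
  apply: filterS (open_nbhs_nbhs (conj UL_open ULq0)) => q Uq.
  have [c1 cu Lq] := ULP Uq.
  rewrite /= /local_rep Lq; set w := chart_inv (1%g : G) q in cu Lq *.
  have [w1 wq] : chart_dom (1%g : G) w /\ chart (1%g : G) w = q := chart_invP c1.
  have Euw : rtrans (u * w)%g 1%g = (u * w)%g by rewrite /rtrans mul1g.
  have Eu : rtrans u 1%g = u by rewrite /rtrans mul1g.
  have EE : rtrans (u * w)%g = rtrans w \o rtrans u.
    by apply/funext => v; rewrite /rtrans /= mulgA.
  rewrite -{1}Euw coord_change_tangent ?Euw //; last exact: rtrans_mdiff.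
  have := @mder_comp R n G (rtrans w) (rtrans u) 1%g u u 1%g z.
  rewrite Eu -EE => ->; try exact: chart_domP; try exact: rtrans_mdiff; last by [].
  rewrite -right_vfieldE -/Yu.
  have [_ ->] := rtrans_local w1 (chart_domP u) cu.
  by rewrite wq.
have E2 : \forall x \near x0, local_rep u (left_vfield y) x =
    ('D_(0, y) m \o (fun x => (x, q0))) x.
  by apply: filterS (nbhs_cod (chart_domP u)) => x; exact: left_rep.
refine (etrans (near_eq_derive y E1) (etrans _ (esym (near_eq_derive Yu E2)))).
have [_ ->] := derive_pairr y (((mC 2%N).2 (Yu, 0)).1 _ Um).
have [_ ->] := derive_pairl Yu (((mC 2%N).2 (0, y)).1 _ Um).
exact: (clairaut_row _ _ (mdom_open (a := u) (b := 1%g) (c := u)) Um (mC 2%N)).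
Qed.

Lemma sub_cancel (W : zmodType) (s t e e' b c : W) :
  s = b + e -> t = c + e' -> e = e' -> s - t = b - c.
Proof. by move=> -> -> ->; rewrite opprD addrACA subrr addr0. Qed.

(** Left-invariant fields are [L]-related to themselves ([E]). Differentiating this relation gives
    the image under [L] of a derivative at the unit plus a second derivative of [L]; the latter is
    symmetric and drops out of the bracket. *)
Lemma bracket_left_left y z : lie_bracket (left_vfield y) (left_vfield z) u =
  left_vfield (@lie_algebra_bracket R n G y z) u.
Proof.
pose Y1 z := local_rep (1%g : G) (left_vfield z).
have c1 : cod (1%g : G) q0 := cod_chart (chart_domP _).
have dY1 z' : differentiable (Y1 z') q0 := (left_rep_Ck z' 1%g 1%N).1 _ c1.
have dYu z' : differentiable (local_rep u (left_vfield z')) x0 :=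
  (left_rep_Ck z' u 1%N).1 _ codx0.
have Y1q0 z' : Y1 z' q0 = z' by rewrite /Y1 local_rep_center left_vfield1.
have E z' : \forall q \near q0, (local_rep u (left_vfield z') \o L) q =
    'D_(Y1 z' q) L q.
  apply: filterS (open_nbhs_nbhs (conj UL_open ULq0)) => q Uq.
  have [cq cu Lq] := ULP Uq.
  rewrite /= /Y1 /local_rep Lq; set w := chart_inv (1%g : G) q in cu Lq *.
  have [w1 wq] : chart_dom (1%g : G) w /\ chart (1%g : G) w = q := chart_invP cq.
  rewrite -tangent_ltrans_left -[(u * w)%g]/(ltrans u w).
  rewrite coord_change_tangent //; last exact: ltrans_mdiff.
  have := @mder_comp R n G (ltrans u) id w 1%g u w (left_vfield z' w).
  rewrite -coord_changeE => H.
  transitivity (mder (ltrans u) 1%g u w (coord_change 1%g w (left_vfield z' w))).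
    by apply: H => //; [exact: mdiff_id|exact: ltrans_mdiff|exact: chart_domP].
  have [_ ->] := ltrans_local (chart_domP u) w1 cu.
  rewrite wq.
  set v := coord_change _ _ _.
  by have [_ <-] := derive_pairr v (mloc_diff Uq).
have D y' z' : 'D_(left_vfield y' u) (local_rep u (left_vfield z')) x0 =
    'D_('D_y' (Y1 z') q0) L q0 + 'D_y' ('D_z' L) q0.
  refine (etrans (derive_along_left y' (dYu z')) _).
  refine (etrans (near_eq_derive y' (E z')) _).
  refine (etrans (derive_along_field y' UL_open ULq0 (LC 2%N) (dY1 z')) _).
  by rewrite Y1q0.
have dL : differentiable L q0 := (LC 1%N).1 _ ULq0.
have C := clairaut_row z y UL_open ULq0 (LC 2%N).
refine (etrans (sub_cancel (D y z) (D z y) C) _).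
refine (etrans (congr2 (fun s t : V => s - t) (deriveE _ dL) (deriveE _ dL)) _).
refine (etrans (esym (linearB _ _ _)) _).
refine (etrans (esym (deriveE _ dL)) (etrans (esym (left_L _)) _)).
by rewrite /lie_algebra_bracket /lie_bracket !left_vfield1.
Qed.

End Brackets.

End InvariantFields.

(** * Linear connections *)

Section SmoothFunctions.
Context {R : realType} {n : nat} {M : manifoldType R n}.
Local Notation V := 'rV[R]_n.
Implicit Types (u : M) (X Y : M -> V) (f h : M -> R).

Let oc (a : M) : open (cod a). Proof. exact: chart_cod_open. Qed.

Lemma smooth_fun_cst (c : R) : smooth_fun (fun _ : M => c).
Proof. by move=> a k; apply: Ck_cst. Qed.

Lemma smooth_funD f h : smooth_fun f -> smooth_fun h ->
  smooth_fun (fun u => f u + h u).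
Proof. by move=> sf sh a k; exact: (CkD (@oc a) (sf a k) (sh a k)). Qed.

Lemma smooth_funM f h : smooth_fun f -> smooth_fun h ->
  smooth_fun (fun u => f u * h u).
Proof. by move=> sf sh a k; exact: (CkM (@oc a) (sf a k) (sh a k)). Qed.

Lemma smooth_fun_sum (I : Type) (r : seq I) (F : I -> M -> R) :
  (forall i, smooth_fun (F i)) -> smooth_fun (fun u => \sum_(i <- r) F i u).
Proof.
move=> sF; elim: r => [|i r IH].
  by under eq_fun do rewrite big_nil; exact: smooth_fun_cst.
by under eq_fun do rewrite big_cons; exact: smooth_funD.
Qed.

Lemma smooth_fun_prod (I : Type) (r : seq I) (F : I -> M -> R) :
  (forall i, smooth_fun (F i)) -> smooth_fun (fun u => \prod_(i <- r) F i u).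
Proof.
move=> sF; elim: r => [|i r IH].
  by under eq_fun do rewrite big_nil; exact: smooth_fun_cst.
by under eq_fun do rewrite big_cons; exact: smooth_funM.
Qed.

Lemma smooth_fun_diff f u a : smooth_fun f -> chart_dom a u ->
  differentiable ((f : M -> R^o) \o chart_inv a) (chart a u).
Proof. by move=> sf au; apply: (sf a 1%N).1; exact: cod_chart. Qed.

Let sd f u : smooth_fun f ->
  differentiable ((f : M -> R^o) \o chart_inv u) (chart u u).
Proof. by move=> sf; apply: smooth_fun_diff => //; exact: chart_domP. Qed.

Lemma vfield_app_cst X (c : R) u : vfield_app X (fun=> c) u = 0.
Proof. exact: derive_cst. Qed.

Lemma vfield_appD X f h u : smooth_fun f -> smooth_fun h ->
  vfield_app X (fun w => f w + h w) u = vfield_app X f u + vfield_app X h u.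
Proof. by move=> sf sh; apply: deriveD; apply: diff_derivable; exact: sd. Qed.

Lemma vfield_appM X f h u : smooth_fun f -> smooth_fun h ->
  vfield_app X (fun w => f w * h w) u =
  vfield_app X f u * h u + f u * vfield_app X h u.
Proof.
move=> sf sh.
have dF := @diff_derivable _ _ _ _ _ (X u) (sd u sf).
have dH := @diff_derivable _ _ _ _ _ (X u) (sd u sh).
have mul_swap (a b c d a' b' : R) :
    a = a' -> b = b' -> a * c + b * d = d * b' + a' * c.
  by move=> -> ->; rewrite addrC [_ * d]mulrC.
refine (etrans (deriveM dF dH) (mul_swap _ _ _ _ _ _ _ _)); rewrite /= chartK //;
exact: chart_domP.
Qed.

Lemma vfield_app_sum X (I : Type) (r : seq I) (F : I -> M -> R) u :
  (forall i, smooth_fun (F i)) ->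
  vfield_app X (fun w => \sum_(i <- r) F i w) u = \sum_(i <- r) vfield_app X (F i) u.
Proof.
move=> sF; elim: r => [|i r IH].
  by under eq_fun do rewrite big_nil; rewrite big_nil vfield_app_cst.
under eq_fun do rewrite big_cons.
by rewrite vfield_appD // ?IH ?big_cons //; exact: smooth_fun_sum.
Qed.

(** The conditional inside the product avoids division and matches the slots of [pushF]. *)
Lemma vfield_app_prod X p (F : 'I_p -> M -> R) u : (forall i, smooth_fun (F i)) ->
  vfield_app X (fun w => \prod_(k < p) F k w) u =
  \sum_(k < p) \prod_(l < p) (if l == k then vfield_app X (F l) u else F l u).
Proof.
elim: p F => [|p IH] F sF.
  by under eq_fun do rewrite big_ord0; rewrite big_ord0 vfield_app_cst.
under eq_fun do rewrite big_ord_recl.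
rewrite vfield_appM //; last exact: smooth_fun_prod.
rewrite big_ord_recl IH //; congr (_ + _).
  by rewrite big_ord_recl /=.
by rewrite mulr_sumr; apply: eq_bigr => k _; rewrite big_ord_recl /=.
Qed.

Lemma smooth_fieldE p (K : M -> tensor R n p) : smooth_field K <->
  forall a i, smooth_on (cod a) (fun x : V =>
    pushM (lin1_mx (coord_change a (chart_inv a x))) (K (chart_inv a x)) i : R^o).
Proof.
split=> sK a i.
  by under eq_fun do rewrite -push_tensorE; exact: sK.
by under eq_fun do rewrite push_tensorE; exact: sK.
Qed.

Lemma smooth_fieldD p (K L : M -> tensor R n p) : smooth_field K -> smooth_field L ->
  smooth_field (fun u => K u + L u).
Proof.
move=> /smooth_fieldE sK /smooth_fieldE sL; apply/smooth_fieldE => a i k.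
under eq_fun do rewrite linearD ffunE.
exact: (CkD (@oc a) (sK a i k) (sL a i k)).
Qed.

Lemma smooth_fieldZ p f (K : M -> tensor R n p) : smooth_fun f -> smooth_field K ->
  smooth_field (fun u => f u *: K u).
Proof.
move=> sf /smooth_fieldE sK; apply/smooth_fieldE => a i k.
under eq_fun do rewrite linearZ ffunE.
exact: (CkM (@oc a) (sf a k) (sK a i k)).
Qed.

Lemma smooth_field0 p : smooth_field (fun _ : M => 0 : tensor R n p).
Proof.
apply/smooth_fieldE => a i k; under eq_fun do rewrite linear0 ffunE.
exact: Ck_cst.
Qed.

Lemma smooth_field_sum p (I : Type) (r : seq I) (F : I -> M -> tensor R n p) :
  (forall i, smooth_field (F i)) -> smooth_field (fun u => \sum_(i <- r) F i u).
Proof.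
move=> sF; elim: r => [|i r IH].
  by under eq_fun do rewrite big_nil; exact: smooth_field0.
by under eq_fun do rewrite big_cons; exact: (smooth_fieldD (sF i) IH).
Qed.

Lemma smooth_field_mul p q (K : M -> tensor R n p) (L : M -> tensor R n q) :
  smooth_field K -> smooth_field L -> smooth_field (fun u => tensor_mul (K u) (L u)).
Proof.
move=> /smooth_fieldE sK /smooth_fieldE sL; apply/smooth_fieldE => a i k.
under eq_fun do rewrite pushM_mul ffunE.
exact: (CkM (@oc a) (sK a _ k) (sL a _ k)).
Qed.

(** The constant 1 as a tensor of degree 0; the vector 0 is a dummy, as the family is empty. *)
Lemma smooth_field_unit :
  smooth_field (fun u : M => pure_tensor (fun k : 'I_0 => 0)).
Proof.
apply/smooth_fieldE => a i k; under eq_fun do rewrite /pushM pushF_pure pure_tensor0.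
exact: Ck_cst.
Qed.

Lemma smooth_pure p (Y : 'I_p -> M -> V) : (forall k, smooth_vfield (Y k)) ->
  smooth_field (fun u => pure_tensor (fun k => Y k u)).
Proof.
elim: p Y => [|p IH] Y sY.
  have -> : (fun u => pure_tensor (Y^~ u)) =
      (fun u : M => pure_tensor (fun k : 'I_0 => 0)).
    by apply/funext => u; apply/ffunP => i; rewrite !pure_tensor0.
  exact: smooth_field_unit.
under eq_fun do rewrite pure_tensorS.
exact: (smooth_field_mul (sY ord0) (IH (fun k => Y (lift ord0 k)) (fun k => sY _))).
Qed.

Lemma smooth_vfieldZ f X : smooth_fun f -> smooth_vfield X ->
  smooth_vfield (fun u => f u *: X u).
Proof.
move=> sf sX; rewrite /smooth_vfield /vfield_tensor.
by under eq_fun do rewrite vec_tensorZ; exact: (smooth_fieldZ sf sX).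
Qed.

Lemma smooth_vfield_sum (I : Type) (r : seq I) (F : I -> M -> V) :
  (forall i, smooth_vfield (F i)) -> smooth_vfield (fun u => \sum_(i <- r) F i u).
Proof.
move=> sF; rewrite /smooth_vfield /vfield_tensor.
by under eq_fun do rewrite vec_tensor_sum;
  exact: (@smooth_field_sum 1%N I r (fun i => vfield_tensor (F i)) sF).
Qed.

End SmoothFunctions.

(** * Covariant derivatives of tensors in a frame *)

Section Connections.
Context {R : realType} {n : nat} {M : manifoldType R n}.
Local Notation V := 'rV[R]_n.
Variable D : @tensor_derivative R n M.
Hypothesis DP : linear_connection D.
Implicit Types (u : M) (X Y : M -> V) (f h : M -> R).

Lemma conn_scale p X (c : R) (K : M -> tensor R n p) u :
  smooth_vfield X -> smooth_field K ->
  D X (fun w => c *: K w) u = c *: D X K u.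
Proof.
move=> sX sK; rewrite (conn_leibniz DP sX (smooth_fun_cst c) sK).
by rewrite vfield_app_cst scale0r add0r.
Qed.

Lemma conn_zero p X u : smooth_vfield X -> D X (fun _ => 0 : tensor R n p) u = 0.
Proof.
move=> sX; have E : (fun _ : M => 0 : tensor R n p) = (fun _ => 0 *: 0).
  by apply/funext => w; rewrite scale0r.
rewrite E (conn_scale 0 u sX (@smooth_field0 R n M p)); exact: scale0r.
Qed.

Lemma conn_sumr p X (I : Type) (r : seq I) (F : I -> M -> tensor R n p) u :
  smooth_vfield X -> (forall i, smooth_field (F i)) ->
  D X (fun w => \sum_(i <- r) F i w) u = \sum_(i <- r) D X (F i) u.
Proof.
move=> sX sF; elim: r => [|i r IH].
  have E : (fun w => \sum_(i <- [::]) F i w) = (fun _ : M => 0 : tensor R n p).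
    by apply/funext => w; rewrite big_nil.
  by rewrite E big_nil conn_zero.
have E : (fun w => \sum_(j <- i :: r) F j w) =
    (fun w => F i w + \sum_(j <- r) F j w).
  by apply/funext => w; rewrite big_cons.
rewrite E (conn_addr DP sX (sF i) (smooth_field_sum r sF)).
by rewrite IH big_cons.
Qed.

Lemma smooth_vfield0 : smooth_vfield (fun _ : M => 0 : V).
Proof.
rewrite /smooth_vfield /vfield_tensor.
by under eq_fun do rewrite vec_tensor0; exact: smooth_field0.
Qed.

Lemma conn_suml p (I : Type) (r : seq I) (f : I -> M -> R) (X : I -> M -> V)
    (K : M -> tensor R n p) u :
  (forall i, smooth_fun (f i)) -> (forall i, smooth_vfield (X i)) ->
  smooth_field K ->
  D (fun w => \sum_(i <- r) f i w *: X i w) K u = \sum_(i <- r) f i u *: D (X i) K u.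
Proof.
move=> sf sX sK; elim: r => [|i r IH].
  have E : (fun w => \sum_(i <- [::]) f i w *: X i w) = (fun _ => 0 *: 0).
    by apply/funext => w; rewrite big_nil scale0r.
  rewrite E (conn_scalel DP (smooth_fun_cst 0) smooth_vfield0 sK u).
  by rewrite scale0r big_nil.
have E : (fun w => \sum_(j <- i :: r) f j w *: X j w) =
    (fun w => f i w *: X i w + \sum_(j <- r) f j w *: X j w).
  by apply/funext => w; rewrite big_cons.
rewrite E.
have s1 := smooth_vfieldZ (sf i) (sX i).
have s2 := smooth_vfield_sum r (fun i => smooth_vfieldZ (sf i) (sX i)).
by rewrite (conn_addl DP s1 s2 sK) (conn_scalel DP (sf i) (sX i) sK) IH big_cons.
Qed.

Lemma conn_vfield X Y u :
  D X (vfield_tensor Y) u = vec_tensor (vfield_derivative D X Y u).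
Proof. by rewrite /vfield_derivative tensor_vecK. Qed.

(** Induction on the degree by the Leibniz rule. In degree 0 the connection differentiates
    functions, and the empty product is the constant 1. *)
Lemma conn_pure p X (Y : 'I_p -> M -> V) u :
  smooth_vfield X -> (forall k, smooth_vfield (Y k)) ->
  D X (fun w => pure_tensor (fun k => Y k w)) u =
  \sum_(k < p) pure_tensor
    (fun l => if l == k then vfield_derivative D X (Y l) u else Y l u).
Proof.
move=> sX; elim: p Y => [|p IH] Y sY.
  have E : (fun u => pure_tensor (Y^~ u)) =
      (fun u : M => pure_tensor (fun k : 'I_0 => 0 : V)).
    by apply/funext => w; apply/ffunP => i; rewrite !pure_tensor0.
  rewrite E big_ord0; apply/ffunP => i.
  rewrite (conn_deg0 DP sX smooth_field_unit).
  under [X in vfield_app _ X]eq_fun do rewrite pure_tensor0.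
  by rewrite vfield_app_cst ffunE.
have E : (fun w => pure_tensor (fun k => Y k w)) = (fun w => tensor_mul
    (vec_tensor (Y ord0 w)) (pure_tensor (fun k => Y (lift ord0 k) w))).
  by apply/funext => w; rewrite pure_tensorS.
rewrite E; have sP := smooth_pure (fun k => sY (lift ord0 k)).
refine (etrans (conn_tensor DP sX (sY ord0) sP u) _).
rewrite big_ord_recl; congr (_ + _).
  rewrite conn_vfield pure_tensorS; congr (tensor_mul _ _).
rewrite IH // tensor_mul_sumr; apply: eq_bigr => k _.
by rewrite [RHS]pure_tensorS.
Qed.

Section Frame.
Variables (E : 'I_n -> M -> V) (Gam : 'I_n -> 'M[R]_n).
Hypothesis sE : forall i, smooth_vfield (E i).

(** The rows are the frame vectors, so [pushM (frame_mx u) C] is the tensor at [u] with coefficients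
    [C] in the frame. *)
Definition frame_mx u : 'M[R]_n := \matrix_i E i u.

Hypothesis DE : forall j i u,
  vfield_derivative D (E j) (E i) u = row i (Gam j *m frame_mx u).

Lemma frame_fieldE p (C : tensor R n p) : (fun w => pushM (frame_mx w) C) =
  (fun w => \sum_i C i *: pure_tensor (fun k => E (i k) w)).
Proof.
apply/funext => w; rewrite /pushM pushF_rows; apply: eq_bigr => i _.
by under [X in pure_tensor X]eq_fun do rewrite rowK.
Qed.

Lemma smooth_frame_monomial p (c : R) (i : {ffun 'I_p -> 'I_n}) :
  smooth_field (fun w => c *: pure_tensor (fun k => E (i k) w)).
Proof.
exact: (smooth_fieldZ (smooth_fun_cst c) (smooth_pure (fun k => sE (i k)))).
Qed.

(** Constant coefficients have no derivative, so only the frame vectors are differentiated, one slot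
    at a time; this is the derivation [derM]. *)
Lemma conn_frame_field p j (C : tensor R n p) u :
  D (E j) (fun w => pushM (frame_mx w) C) u = pushM (frame_mx u) (derM (Gam j) C).
Proof.
rewrite frame_fieldE conn_sumr //; last by move=> i; exact: smooth_frame_monomial.
have sP i : smooth_field (fun w => pure_tensor (fun k : 'I_p => E (i k) w)).
  exact: smooth_pure.
rewrite pushM_derM; under [RHS]eq_bigr => k _ do rewrite pushF_rows.
rewrite exchange_big /=; apply: eq_bigr => i _.
rewrite conn_scale // conn_pure // -scaler_sumr; congr (_ *: _).
apply: eq_bigr => k _; congr pure_tensor; apply/funext => l.
by case: eqP => [->|_]; [rewrite DE|rewrite rowK].
Qed.

End Frame.
End Connections.

(** * Orthonormal bases *)

Section InnerProduct.
Context {R : realType} {n : nat}.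
Local Notation V := 'rV[R]_n.
Variable b : V -> V -> R.
Hypothesis b_linear : forall (c : R) (v w z : V),
  b (c *: v + w) z = c * b v z + b w z.
Hypothesis b_sym : forall v w, b v w = b w v.

Lemma inner0l z : b 0 z = 0.
Proof.
have := b_linear 1 0 0 z; rewrite scaler0 add0r mul1r => /eqP.
by rewrite -subr_eq0 opprD addNKr oppr_eq0 => /eqP.
Qed.

Lemma innerZl c v z : b (c *: v) z = c * b v z.
Proof. by rewrite -[c *: v]addr0 b_linear inner0l addr0. Qed.

Lemma innerDl v w z : b (v + w) z = b v z + b w z.
Proof. by rewrite -[v]scale1r b_linear mul1r scale1r. Qed.

Lemma innerBl v w z : b (v - w) z = b v z - b w z.
Proof. by rewrite -scaleN1r innerDl innerZl mulN1r. Qed.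

Lemma inner_suml (I : Type) (r : seq I) (F : I -> V) z :
  b (\sum_(i <- r) F i) z = \sum_(i <- r) b (F i) z.
Proof.
elim: r => [|i r IH]; first by rewrite !big_nil inner0l.
by rewrite !big_cons innerDl IH.
Qed.

Lemma inner_comb (I : finType) (c : I -> R) (F : I -> V) z :
  b (\sum_i c i *: F i) z = \sum_i c i * b (F i) z.
Proof. by rewrite inner_suml; apply: eq_bigr => i _; rewrite innerZl. Qed.

Section OrthonormalBasis.
Variable E : 'I_n -> V.
Hypothesis EE : forall i j, b (E i) (E j) = (i == j)%:R.

Lemma inner_comb_basis (c : 'I_n -> R) j : b (\sum_i c i *: E i) (E j) = c j.
Proof.
rewrite inner_comb (bigD1 j) //= EE eqxx mulr1 big1 ?addr0 // => i ij.
by rewrite EE (negbTE ij) mulr0.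
Qed.

Lemma orthonormal_unitmx : (\matrix_i E i) \in unitmx.
Proof.
rewrite -row_free_unit; apply: inj_row_free => v; rewrite mulmx_sum_row => v0.
apply/rowP => j; rewrite mxE -(inner_comb_basis (v 0) j).
under eq_bigr => i _ do rewrite -(rowK E i).
by rewrite v0 inner0l.
Qed.

Lemma orthonormal_expand v : v = \sum_j b v (E j) *: E j.
Proof.
have [w ->] : exists w : 'I_n -> R, v = \sum_i w i *: E i.
  exists ((v *m invmx (\matrix_i E i)) 0).
  rewrite -{1}(mulmxKV orthonormal_unitmx v) mulmx_sum_row.
  by apply: eq_bigr => i _; rewrite rowK.
by apply: eq_bigr => j _; rewrite inner_comb_basis.
Qed.

End OrthonormalBasis.

Hypothesis b_posdef : forall v, v != 0 -> 0 < b v v.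

Definition orthonormal_seq (s : seq V) := forall i j,
  (i < size s)%N -> (j < size s)%N -> b s`_i s`_j = (i == j)%:R.

Lemma orthonormal_extend (s : seq V) (U : {vspace V}) :
  orthonormal_seq s -> {subset s <= U} -> (size s < \dim U)%N ->
  exists v, [/\ v \in U, b v v = 1 & forall w, w \in s -> b w v = 0].
Proof.
move=> os sU ltsU.
have /subvPn[w wU ws] : ~~ (U <= span s)%VS.
  by apply/negP => /dimvS; apply/negP; rewrite -ltnNge (leq_ltn_trans (dim_span s)).
pose v0 := w - \sum_(i < size s) b w s`_i *: s`_i.
have v0U : v0 \in U.
  rewrite rpredB // rpred_sum // => i _; rewrite rpredZ //.
  by apply: sU; exact: mem_nth.
have v00 : v0 != 0.
  apply: contra ws; rewrite subr_eq0 => /eqP ->; rewrite rpred_sum // => i _.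
  by rewrite rpredZ // memv_span // mem_nth.
have v0s j : (j < size s)%N -> b v0 s`_j = 0.
  move=> js; rewrite /v0 innerDl -scaleN1r innerZl inner_comb mulN1r.
  rewrite (bigD1 (Ordinal js)) //= os // eqxx mulr1 big1 ?addr0 ?subrr // => i ij.
  by rewrite os // -[(i : nat) == j]/(i == Ordinal js) (negbTE ij) mulr0.
have pos := b_posdef v00.
exists ((Num.sqrt (b v0 v0))^-1 *: v0); split.
- by rewrite rpredZ.
- rewrite innerZl b_sym innerZl mulrA -invfM -expr2 sqr_sqrtr ?ltW //.
  by rewrite mulVf // gt_eqF.
- move=> z /(nthP 0)[j js <-].
  by rewrite b_sym innerZl v0s // mulr0.
Qed.

Lemma orthonormal_cons (s : seq V) v : orthonormal_seq s -> b v v = 1 ->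
  (forall w, w \in s -> b w v = 0) -> orthonormal_seq (v :: s).
Proof.
move=> os vv sv [|i] [|j] //= i1 j1; first by rewrite b_sym sv // mem_nth.
  by rewrite sv // mem_nth.
by rewrite os.
Qed.

Lemma orthonormal_exists (U : {vspace V}) k : (k <= \dim U)%N ->
  exists s, [/\ orthonormal_seq s, {subset s <= U} & size s = k].
Proof.
elim: k => [|k IH] kU; first by exists [::].
have [s [os sU sk]] := IH (ltnW kU).
have [|v [vU vv vs]] := orthonormal_extend os sU; first by rewrite sk.
exists (v :: s); split; [exact: orthonormal_cons| |by rewrite /= sk].
by move=> w; rewrite inE => /orP[/eqP ->|/sU].
Qed.

(** An orthonormal family of [h] of full size is completed by one unit vector. That this vector is
    orthogonal to all of [h], and not only to the family, follows by counting dimensions. *)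
Lemma orthonormal_adapted (h : {vspace V}) (o : 'I_n) : (\dim h).+1 = n ->
  exists E : 'I_n -> V, (forall i j, b (E i) (E j) = (i == j)%:R) /\
    (forall i, i != o -> E i \in h) /\ (forall w, w \in h -> b w (E o) = 0).
Proof.
move=> hn; have dV : \dim (fullv : {vspace V}) = n.
  by rewrite dimvf -[RHS]mul1n.
have [s [os sh sk]] := orthonormal_exists (leqnn (\dim h)).
have [||v [_ vv vs]] := orthonormal_extend (U := fullv) os.
- by move=> w _; exact: memvf.
- by rewrite dV sk -[X in (_ < X)%N]hn.
have oc := orthonormal_cons os vv vs.
have n0 : (0 < n)%N by rewrite -hn.
pose E0 (i : 'I_n) := (v :: s)`_i.
have E0E i j : b (E0 i) (E0 j) = (i == j)%:R by apply: oc; rewrite /= sk hn.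
(* The transposition moves the added vector from the head of the list to index [o]. *)
pose E i := E0 (tperm o (Ordinal n0) i).
have EE i j : b (E i) (E j) = (i == j)%:R by rewrite E0E (inj_eq perm_inj).
have Eh i : i != o -> E i \in h.
  move=> io; rewrite /E; set j := tperm _ _ i.
  have : j != Ordinal n0 by rewrite /j -{2}(tpermL o (Ordinal n0)) (inj_eq perm_inj).
  case: j => -[|j] jn // _; rewrite /E0 /=; apply/sh/mem_nth.
  by rewrite sk -ltnS hn.
exists E; split => //; split => // w wh.
(* A component of [w] along [E o] would put [E o] into [h], and [h] would be the whole space. *)
apply/eqP; apply: contraT => c0.
have Eo : E o \in h.
  have wE := orthonormal_expand EE w; rewrite (bigD1 o) //= in wE.
  have -> : E o = (b w (E o))^-1 *: (w - \sum_(i | i != o) b w (E i) *: E i).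
    by rewrite {2}wE addrK scalerA mulVf // scale1r.
  rewrite rpredZ // rpredB // rpred_sum // => i io.
  by rewrite rpredZ // Eh.
have : (fullv <= h)%VS.
  apply/subvP => v' _; rewrite (orthonormal_expand EE v') rpred_sum // => i _.
  by rewrite rpredZ //; have [->//|/Eh] := eqVneq i o.
by move=> /dimvS; rewrite dV -[X in (X <= _)%N]hn ltnn.
Qed.

End InnerProduct.

(** * Flatness and metric frames *)

Section KoszulAlgebra.
Context {R : realType} {n : nat}.
Variables (c gam : 'I_n -> 'I_n -> 'I_n -> R) (o : 'I_n).
Hypothesis skew : forall i j k, gam i j k = - gam i k j.
Hypothesis torsion : forall i j k, gam i j k - gam j i k = c i j k.
Hypothesis abelian : forall i j k, i != o -> j != o -> c i j k = 0.
Hypothesis ideal : forall i j, c i j o = 0.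
Hypothesis flatness : forall i j k l, \sum_m gam j k m * gam i m l -
  \sum_m gam i k m * gam j m l - \sum_m c i j m * gam m k l = 0.

Let eq_opp0 (x : R) : x = - x -> x = 0.
Proof. by move=> E; lra. Qed.

(** [a] is minus the symmetric part of ad e_0, and [E] is the component along [l] of R(E_o, E_i)
    E_o. In the trace over [i = l] the two products with [w] cancel, and since [a] is symmetric the
    rest is the sum of its squared entries. *)
Lemma flat_gam_o j m : gam j o m = 0.
Proof.
pose a j m := gam j o m; pose w j m := gam o j m.
have a_sym i k : a i k = a k i.
  have := torsion i k o; rewrite ideal => /eqP; rewrite subr_eq0 => /eqP E.
  by rewrite /a skew E -skew.
have ao k : a o k = 0 by rewrite a_sym /a; apply: eq_opp0; exact: skew.
have E i l : \sum_k a i k * w k l - \sum_k w i k * a k l + \sum_k a i k * a k l = 0.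
  have := flatness o i o l.
  rewrite [X in _ - X - _]big1 => [|k _]; last by rewrite -/(a o k) ao mul0r.
  under [X in _ - X]eq_bigr => k _ do rewrite -torsion mulrBl.
  rewrite sumrB subr0 opprB => F0.
  by rewrite -addrA [- _ + _]addrC; exact: F0.
have : \sum_i \sum_k a i k ^+ 2 = 0.
  transitivity (\sum_i (\sum_k a i k * w k i - \sum_k w i k * a k i +
                        \sum_k a i k * a k i)); last first.
    by rewrite big1 // => i _; exact: E.
  rewrite big_split sumrB /= [X in _ - X]exchange_big /=.
  under [X in _ - X]eq_bigr => i _ do under eq_bigr => k _ do rewrite mulrC.
  rewrite subrr add0r; apply: eq_bigr => i _; apply: eq_bigr => k _.
  by rewrite expr2 [X in _ * X]a_sym.
move/eqP; rewrite psumr_eq0; last first.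
  by move=> i _; apply: sumr_ge0 => k _; exact: sqr_ge0.
move=> /allP/(_ j (mem_index_enum j)) /=.
rewrite psumr_eq0; last by move=> k _; exact: sqr_ge0.
by move=> /allP/(_ m (mem_index_enum m)) /=; rewrite sqrf_eq0 => /eqP.
Qed.

(** Outside [o], [gam] is symmetric in its first two indices because the ideal is abelian, and skew
    in its last two. Alternating the two rules through the three indices returns to the start with
    the opposite sign. *)
Lemma flat_gam i j k : i != o -> gam i j k = 0.
Proof.
move=> io; have [->|jo] := eqVneq j o; first exact: flat_gam_o.
have [->|ko] := eqVneq k o; first by rewrite skew flat_gam_o oppr0.
have sw i' j' k' : i' != o -> j' != o -> gam i' j' k' = gam j' i' k'.
  by move=> io' jo'; apply/eqP; rewrite -subr_eq0 torsion abelian.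
apply: eq_opp0.
rewrite {1}(sw _ _ _ io jo) skew (sw _ _ _ jo ko) skew opprK.
by rewrite (sw _ _ _ ko io) skew.
Qed.

End KoszulAlgebra.

(** * Global orthonormal frames and the Killing operator *)

Section MetricFrames.
Context {R : realType} {n : nat} {M : manifoldType R n}.
Local Notation V := 'rV[R]_n.
Variables (g : M -> V -> V -> R) (D : @tensor_derivative R n M).
Hypothesis gP : riemannian_metric g.
Hypothesis DP : linear_connection D.
Variable E : 'I_n -> M -> V.
Hypothesis sE : forall i, smooth_vfield (E i).
Hypothesis EE : forall u i j, g u (E i u) (E j u) = (i == j)%:R.
Implicit Types (X Y : M -> V) (f : M -> R) (u : M).

Let g_lin u := metric_linear gP u.

Lemma frame_expand u v : v = \sum_j g u v (E j u) *: E j u.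
Proof. exact: (orthonormal_expand (g_lin u) (EE u)). Qed.

(* The frame [E] is global and [e i] has smooth coordinates in it, so tensoriality
   of the connection in its first argument needs no cut-off functions. *)
Lemma killing_op_frame p (K : M -> tensor R n p) (e : 'I_n -> M -> V) u :
  smooth_field K -> orthonormal_frame_near g e u ->
  killing_op D e K u = killing_op D E K u.
Proof.
move=> sK [se ee]; have {}ee := nbhs_singleton ee.
pose q i j w := g w (e i w) (E j w).
have sq i j : smooth_fun (q i j) by exact: (metric_smooth gP).
have eq i : e i = (fun w => \sum_j q i j w *: E j w).
  by apply/funext => w; exact: frame_expand.
pose Q := \matrix_(i, j) q i j u.
have QQ : Q *m Q^T = 1%:M.
  apply/matrixP => i k; rewrite !mxE -ee {1}(frame_expand u (e i u)).
  rewrite (inner_comb (g_lin u)); apply: eq_bigr => j _; rewrite !mxE; congr (_ * _).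
  exact: (Defs.metric_sym gP u _ _).
have {}QQ l j : \sum_i q i l u * q i j u = (l == j)%:R.
  have /matrixP/(_ l j) := mulmx1C QQ; rewrite !mxE => <-.
  by apply: eq_bigr => i _; rewrite !mxE.
have De i : D (e i) K u = \sum_j q i j u *: D (E j) K u.
  by rewrite [in LHS]eq (conn_suml DP) // => j; exact: sq.
rewrite /killing_op.
transitivity (\sum_i \sum_l \sum_j (q i l u * q i j u) *:
    sym_mul (vec_tensor (E l u)) (D (E j) K u)).
  apply: eq_bigr => i _; rewrite De {1}eq vec_tensor_sum sym_mul_suml.
  apply: eq_bigr => l _; rewrite sym_mul_sumr; apply: eq_bigr => j _.
  by rewrite vec_tensorZ sym_mulZl sym_mulZr scalerA.
rewrite exchange_big /=; apply: eq_bigr => l _; rewrite exchange_big /=.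
under eq_bigr => j _ do rewrite -scaler_suml QQ.
rewrite (bigD1 l) //= eqxx scale1r big1 ?addr0 // => j jl.
by rewrite eq_sym (negbTE jl) scale0r.
Qed.

Lemma killing_frame p (K : M -> tensor R n p) : smooth_field K ->
  (forall u, killing_op D E K u = 0) -> killing g D K.
Proof. by move=> sK K0 u e eP; rewrite (killing_op_frame sK eP). Qed.

Lemma frame_orthonormal_near u : orthonormal_frame_near g E u.
Proof. by split=> //; apply: nearW => w i j; exact: EE. Qed.

End MetricFrames.

(** * Functions with zero derivative *)

Section ConstantFunctions.
Context {R : realType} {n : nat} {M : manifoldType R n}.
Local Notation V := 'rV[R]_n.

(** The hypothesis speaks of each point in its own chart only. The chain rule through the transition
    map carries it to every point of one fixed chart. *)
Lemma derive0_near_cst (f : M -> R) a : smooth_fun f ->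
  (forall u v, 'D_v ((f : M -> R^o) \o chart_inv u) (chart u u) = 0) ->
  \forall u \near a, f u = f a.
Proof.
move=> sf f0.
have D0 x : cod a x -> differentiable ((f : M -> R^o) \o chart_inv a) x /\
    forall v, 'D_v ((f : M -> R^o) \o chart_inv a) x = 0.
  move=> ax; split=> [|v]; first exact: (sf a 1%N).1.
  have [au xu] := chart_invP ax; set u := chart_inv a x in au xu.
  have dT : differentiable (chart u \o chart_inv a) x.
    by have := (mdiff_id u).2 a u au (chart_domP u); rewrite xu.
  have Tx : (chart u \o chart_inv a) x = chart u u by [].
  have E : \forall y \near x, ((f : M -> R^o) \o chart_inv a) y =
      ((f : M -> R^o) \o chart_inv u \o (chart u \o chart_inv a)) y.
    have := nbhs_chart_inv au (nbhs_chart_dom (chart_domP u)); rewrite xu.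
    by apply: filterS => y uy /=; rewrite chartK.
  refine (etrans (near_eq_derive v E) _).
  have df : differentiable ((f : M -> R^o) \o chart_inv u)
      ((chart u \o chart_inv a) x).
    by rewrite Tx; apply: smooth_fun_diff => //; exact: chart_domP.
  refine (etrans (derive_comp v dT df) _); rewrite Tx; exact: f0.
have /= N := derive0_locally_cst (chart_cod_open a) (cod_chart (chart_domP a)) D0.
have C := chart_continuous a a (chart_domP a).
have N2 : \forall u \near a,
    f (chart_inv a (chart a u)) = f (chart_inv a (chart a a)).
  exact: C N.
apply: filterS2 N2 (nbhs_chart_dom (chart_domP a)) => u + au.
by rewrite !chartK //; exact: chart_domP.
Qed.

(** A fibre is open, and so is its complement. *)
Lemma connected_locally_cst (T : topologicalType) (W : Type) (f : T -> W) :
  connected [set: T] -> (forall a, \forall u \near a, f u = f a) ->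
  forall u w, f u = f w.
Proof.
move=> cT lf u w; pose B := [set u | f u = f w].
have oB : open B.
  rewrite openE => x Bx; rewrite /interior; apply: filterS (lf x) => y /= E.
  by rewrite /B /= E.
have oC : open (~` B).
  rewrite openE => x Bx; rewrite /interior; apply: filterS (lf x) => y /= E.
  by move=> By; apply: Bx; rewrite /B /= -E.
have BT : B = [set: T].
  apply: cT; first by exists w.
  - by exists B => //; rewrite setTI.
  - by exists B; [rewrite -[B]setCK; exact: open_closedC|rewrite setTI].
by have : [set: T] u by []; rewrite -BT.
Qed.

Lemma frame_cst (f : M -> R) (E : 'I_n -> M -> V) :
  connected [set: M] -> smooth_fun f ->
  (forall u v, exists c : 'I_n -> R, v = \sum_j c j *: E j u) ->
  (forall j u, vfield_app (E j) f u = 0) -> forall u w, f u = f w.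
Proof.
move=> cM sf Eb f0; apply: connected_locally_cst => // a.
apply: derive0_near_cst => // u v; have [c ->] := Eb u v.
have df := smooth_fun_diff sf (chart_domP u).
refine (etrans (deriveE _ df) _); rewrite linear_sum big1 // => j _.
rewrite linearZ; have := f0 j u; rewrite /vfield_app => F.
have -> : 'd ((f : M -> R^o) \o chart_inv u) (chart u u) (E j u) = 0.
  exact: (etrans (esym (deriveE _ df)) F).
exact: scaler0.
Qed.

End ConstantFunctions.

(** * The Levi-Civita connection in a frame *)

Section MetricConnection.
Context {R : realType} {n : nat} {M : manifoldType R n}.
Local Notation V := 'rV[R]_n.
Variables (g : M -> V -> V -> R) (D : @tensor_derivative R n M).
Hypothesis gP : riemannian_metric g.
Hypothesis lc : levi_civita g D.
Variable E : 'I_n -> M -> V.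
Hypothesis sE : forall i, smooth_vfield (E i).
Hypothesis EE : forall u i j, g u (E i u) (E j u) = (i == j)%:R.
Variable c : 'I_n -> 'I_n -> 'I_n -> R.
Hypothesis Ec : forall i j u, lie_bracket (E i) (E j) u = \sum_k c i j k *: E k u.
Implicit Types (X Y : M -> V) (u : M).

Let DP := lc_connection lc.
Let g_lin u := metric_linear gP u.
Local Notation vd := (vfield_derivative D).

Lemma vd_combr X (a : 'I_n -> R) u : smooth_vfield X ->
  vd X (fun w => \sum_k a k *: E k w) u = \sum_k a k *: vd X (E k) u.
Proof.
move=> sX; apply: (can_inj (@vec_tensorK R n)); rewrite -conn_vfield.
have -> : vfield_tensor (fun w => \sum_k a k *: E k w) =
    (fun w => \sum_k a k *: vfield_tensor (E k) w).
  apply/funext => w; rewrite /vfield_tensor vec_tensor_sum.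
  by apply: eq_bigr => k _; rewrite vec_tensorZ.
have sF k : smooth_field (fun w => a k *: vfield_tensor (E k) w).
  exact: (smooth_fieldZ (smooth_fun_cst (a k)) (sE k)).
rewrite (conn_sumr DP _ u sX sF) vec_tensor_sum; apply: eq_bigr => k _.
by rewrite (conn_scale DP (a k) u sX (sE k)) conn_vfield vec_tensorZ.
Qed.

Lemma vd_combl Y (a : 'I_n -> M -> R) u : (forall k, smooth_fun (a k)) ->
  smooth_vfield Y ->
  vd (fun w => \sum_k a k w *: E k w) Y u = \sum_k a k u *: vd (E k) Y u.
Proof.
move=> sa sY; apply: (can_inj (@vec_tensorK R n)); rewrite -conn_vfield.
rewrite (conn_suml DP _ u sa sE sY) vec_tensor_sum; apply: eq_bigr => k _.
by rewrite conn_vfield vec_tensorZ.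
Qed.

(* Koszul formula for the component along [E k] of the derivative of [E j]
   along [E i]. *)
Definition christoffel i j k : R := (c i j k - c j k i + c k i j) / 2.

(** The inner products of the frame are constant, so metric compatibility ([metr]) gives skewness
    without derivative terms. Three instances of it, with the torsion identities ([tors]), determine
    the coefficient by linear algebra. It depends on [c] only and not on [u]. *)
Lemma vd_frame i j u : vd (E i) (E j) u = \sum_k christoffel i j k *: E k u.
Proof.
rewrite (frame_expand gP EE u (vd (E i) (E j) u)); apply: eq_bigr => k _.
congr (_ *: _); pose Gu i j k := g u (vd (E i) (E j) u) (E k u).
have tors i' j' k' : Gu i' j' k' - Gu j' i' k' = c i' j' k'.
  rewrite /Gu -(innerBl (g_lin u)) (lc_torsion_free lc (sE i') (sE j')) Ec.
  exact: (inner_comb_basis (g_lin u) (EE u)).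
have metr i' j' k' : Gu i' j' k' + Gu i' k' j' = 0.
  have := lc_metric lc (sE i') (sE j') (sE k') u.
  have -> : (fun w => g w (E j' w) (E k' w)) = (fun=> (j' == k')%:R).
    by apply/funext => w; rewrite EE.
  by rewrite vfield_app_cst [X in _ = _ + X](Defs.metric_sym gP) => <-.
rewrite -/(Gu i j k) /christoffel -!tors.
have := metr j i k; have := metr k j i; have := metr i j k; lra.
Qed.

(* [M] has to be inhabited: over an empty manifold [c] is arbitrary. *)
Lemma christoffel_torsion i j k : M ->
  christoffel i j k - christoffel j i k = c i j k.
Proof.
move=> u; have T := lc_torsion_free lc (sE i) (sE j) u; rewrite Ec !vd_frame in T.
have := congr1 (fun v => g u v (E k u)) T.
rewrite (innerBl (g_lin u)).
by rewrite !(inner_comb_basis (g_lin u) (EE u)).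
Qed.

Lemma christoffel_skew i j k : M -> christoffel i j k = - christoffel i k j.
Proof.
move=> u; have := lc_metric lc (sE i) (sE j) (sE k) u.
have -> : (fun w => g w (E j w) (E k w)) = (fun=> (j == k)%:R).
  by apply/funext => w; rewrite EE.
rewrite vfield_app_cst [X in _ = _ + X](Defs.metric_sym gP) !vd_frame.
rewrite !(inner_comb_basis (g_lin u) (EE u)) => /esym/eqP.
by rewrite addr_eq0 => /eqP.
Qed.

Lemma christoffel_flat i j k l : M -> flat D ->
  \sum_m christoffel j k m * christoffel i m l -
  \sum_m christoffel i k m * christoffel j m l -
  \sum_m c i j m * christoffel m k l = 0.
Proof.
move=> u fl; have := fl (E i) (E j) (E k) (sE i) (sE j) (sE k) u.
rewrite /curvature.
have vdE i' j' : vd (E i') (E j') = (fun u => \sum_k christoffel i' j' k *: E k u).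
  by apply/funext => w; exact: vd_frame.
have bE : lie_bracket (E i) (E j) = (fun u => \sum_k c i j k *: E k u).
  by apply/funext => w; exact: Ec.
rewrite [vd (E j) (E k)]vdE [vd (E i) (E k)]vdE bE !vd_combr //.
rewrite (vd_combl (a := fun k _ => c i j k)) //; last first.
  by move=> m; exact: smooth_fun_cst.
move=> /(congr1 (fun v => g u v (E l u))).
rewrite (inner0l (g_lin u)) !(innerBl (g_lin u)) !(inner_comb (g_lin u)).
have S (a : 'I_n -> R) (i' : 'I_n -> 'I_n) (j' : 'I_n -> 'I_n) :
  \sum_m a m * g u (vd (E (i' m)) (E (j' m)) u) (E l u) =
  \sum_m a m * christoffel (i' m) (j' m) l.
  apply: eq_bigr => m _; rewrite vd_frame; congr (_ * _).
  exact: (inner_comb_basis (g_lin u) (EE u)).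
by rewrite (S _ (fun=> i) id) (S _ (fun=> j) id) (S _ id (fun=> k)).
Qed.

Section CommutingField.
Variable X : M -> V.
Hypothesis sX : smooth_vfield X.
Hypothesis EX : forall j u, lie_bracket (E j) X u = 0.

Definition frame_coord k u := g u (X u) (E k u).

Lemma smooth_frame_coord k : smooth_fun (frame_coord k).
Proof. exact: (metric_smooth gP). Qed.

Lemma frame_coordE : X = (fun u => \sum_k frame_coord k u *: E k u).
Proof. by apply/funext => u; exact: (frame_expand gP EE). Qed.

(** As the bracket vanishes, the derivative of [X] along [E j] is that of [E j] along [X], which is
    linear over functions in [X]. *)
Lemma vd_commuting j u : vd (E j) X u =
  \sum_k (\sum_i frame_coord i u * christoffel i j k) *: E k u.
Proof.
have := lc_torsion_free lc (sE j) sX u; rewrite EX => /eqP.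
rewrite subr_eq0 => /eqP ->; rewrite {1}frame_coordE.
rewrite (vd_combl _ smooth_frame_coord) //.
under eq_bigr => i _ do rewrite vd_frame scaler_sumr.
rewrite exchange_big /=; apply: eq_bigr => k _; rewrite scaler_suml.
by apply: eq_bigr => i _; rewrite scalerA.
Qed.

(** This is the [E k] component of the vanishing bracket, derived from metric compatibility; the two
    Christoffel terms combine to the torsion, that is, to [c i j k]. *)
Lemma app_commuting j k u :
  vfield_app (E j) (frame_coord k) u = \sum_i frame_coord i u * c i j k.
Proof.
rewrite (lc_metric lc (sE j) sX (sE k)) vd_commuting vd_frame.
rewrite (inner_comb_basis (g_lin u) (EE u)) (Defs.metric_sym gP).
rewrite (inner_comb (g_lin u)) -big_split /=; apply: eq_bigr => i _.
rewrite (Defs.metric_sym gP) -/(frame_coord i u) mulrC -mulrDl mulrC.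
by rewrite -(christoffel_torsion i j k u) (christoffel_skew j k i u).
Qed.

(** By [vd_commuting] the covariant derivative of [X] has the matrix [w], skew because the
    connection is metric. Contracting it with a symmetric product gives 0. *)
Lemma killing_commuting : killing g D (vfield_tensor X).
Proof.
apply: (killing_frame gP DP sE EE sX) => u; rewrite /killing_op.
pose w j k := \sum_i frame_coord i u * christoffel i j k.
have w_skew j k : w k j = - w j k.
  rewrite /w -sumrN; apply: eq_bigr => i _.
  by rewrite (christoffel_skew i k j u) mulrN.
pose S := \sum_j \sum_k w j k *: sym_mul (vec_tensor (E j u)) (vec_tensor (E k u)).
have -> : \sum_i sym_mul (vec_tensor (E i u)) (D (E i) (vfield_tensor X) u) = S.
  apply: eq_bigr => j _.
  rewrite conn_vfield vd_commuting vec_tensor_sum sym_mul_sumr.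
  by apply: eq_bigr => k _; rewrite vec_tensorZ sym_mulZr.
have SN : S = - S.
  rewrite {1}/S exchange_big /= /S -sumrN; apply: eq_bigr => k _.
  by rewrite -sumrN; apply: eq_bigr => j _; rewrite w_skew sym_mul_vecC scaleNr.
have : S *+ 2 = 0 by rewrite mulr2n {1}SN addNr.
move/eqP; rewrite -scaler_nat scaler_eq0 pnatr_eq0 /= => /eqP; exact.
Qed.

End CommutingField.

End MetricConnection.

(** * Flat almost abelian groups *)

Section FlatAlmostAbelian.
Context {R : realType} {n : nat} {G : lieGroupType R n}.
Local Notation V := 'rV[R]_n.
Variables (g : G -> V -> V -> R) (D : @tensor_derivative R n G).
Hypothesis cG : connected [set: G].
Hypothesis gP : riemannian_metric g.
Hypothesis li : left_invariant_metric g.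
Hypothesis lc : levi_civita g D.
Hypothesis fl : flat D.
Variables (o : 'I_n) (e : 'I_n -> V).
Hypothesis ee : forall i j, g 1%g (e i) (e j) = (i == j)%:R.
Hypothesis e_abelian : forall i j, i != o -> j != o ->
  @lie_algebra_bracket R n G (e i) (e j) = 0.
Hypothesis e_ideal : forall x i, i != o ->
  g 1%g (@lie_algebra_bracket R n G x (e i)) (e o) = 0.

Let E i : G -> V := left_vfield (e i).
Let c i j k := g 1%g (@lie_algebra_bracket R n G (e i) (e j)) (e k).
Local Notation gam := (christoffel c).
Local Notation vd := (vfield_derivative D).

Let sE i : smooth_vfield (E i). Proof. exact: left_vfield_smooth. Qed.

Let EE u i j : g u (E i u) (E j u) = (i == j)%:R.
Proof. by have := li u 1%g (e i) (e j); rewrite mulg1 ee. Qed.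

Let Ec i j u : lie_bracket (E i) (E j) u = \sum_k c i j k *: E k u.
Proof.
rewrite bracket_left_left.
rewrite (orthonormal_expand (metric_linear gP 1%g) ee (lie_algebra_bracket _ _)).
rewrite /left_vfield /tangent_map linear_sum; apply: eq_bigr => k _.
by rewrite linearZ.
Qed.

Let gskew i j k := @christoffel_skew R n G g D gP lc E sE EE c Ec i j k 1%g.
Let gtors i j k := @christoffel_torsion R n G g D gP lc E sE EE c Ec i j k 1%g.

Let c_ideal i j : c i j o = 0.
Proof.
have [jo|] := eqVneq j o; last exact: e_ideal.
(* The hypothesis on the ideal covers brackets whose second argument is not [e o]; antisymmetry
   exchanges the arguments, and the bracket of [e o] with itself vanishes. *)
have anti x y : @lie_algebra_bracket R n G x y = - @lie_algebra_bracket R n G y x.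
  exact: lie_bracketC.
rewrite /c anti jo -scaleN1r (innerZl (metric_linear gP 1%g)).
have [->|io] := eqVneq i o; last by rewrite e_ideal // mulr0.
have -> : @lie_algebra_bracket R n G (e o) (e o) = 0 by exact: lie_bracket_self.
by rewrite (inner0l (metric_linear gP 1%g)) mulr0.
Qed.

Let c_abelian i j k : i != o -> j != o -> c i j k = 0.
Proof.
by move=> io jo; rewrite /c e_abelian // (inner0l (metric_linear gP 1%g)).
Qed.

Let gam0 i j k : i != o -> gam i j k = 0.
Proof.
apply: (flat_gam gskew gtors c_abelian c_ideal) => i' j' k' l'.
exact: (christoffel_flat gP lc sE EE Ec i' j' k' l' 1%g fl).
Qed.

Let gam_o j m : gam j o m = 0.
Proof.
apply: (flat_gam_o gskew gtors c_ideal) => i' j' k' l'.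
exact: (christoffel_flat gP lc sE EE Ec i' j' k' l' 1%g fl).
Qed.

(** The matrix of the covariant derivative along [E j] in the frame. For [j = o] it is that of ad
    e_0, since [gam_o] reduces the torsion identity to [gam o i k = c o i k]. *)
Let B j : 'M[R]_n := \matrix_(i, k) gam j i k.

Let B0 j : j != o -> B j = 0.
Proof. by move=> jo; apply/matrixP => i k; rewrite !mxE gam0. Qed.

Let B_skew j : (B j)^T = - B j.
Proof. by apply/matrixP => i k; rewrite !mxE gskew. Qed.

Local Notation F := (frame_mx E).

Let DE j i u : vd (E j) (E i) u = row i (B j *m F u).
Proof.
rewrite (vd_frame gP lc sE EE Ec) row_mul mulmx_sum_row.
by apply: eq_bigr => k _; rewrite !mxE rowK.
Qed.

Let F_unit u : F u \in unitmx.
Proof. exact: (orthonormal_unitmx (metric_linear gP u) (EE u)). Qed.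

Definition adapted_field i : G -> V := if i == o then E o else right_vfield (e i).
Local Notation X := adapted_field.

(** [E o] is parallel by [gam_o]; the right-invariant fields commute with the frame. *)
Lemma adapted_field_killing i : killing_vfield g D (X i) /\
  (left_invariant_vfield (X i) \/ right_invariant_vfield (X i)).
Proof.
rewrite /X; case: eqP => [_|_].
  split; last by left; exact: left_vfield_left_invariant.
  split; first exact: sE.
  apply: (killing_frame gP (lc_connection lc) sE EE (sE o)) => u.
  rewrite /killing_op big1 // => j _; rewrite conn_vfield (vd_frame gP lc sE EE Ec).
  rewrite big1 ?vec_tensor0 ?sym_mul0r // => k _.
  by rewrite gam_o scale0r.
split; last by right; exists (e i).
have sX := right_vfield_smooth (G := G) (e i).
split; first exact: sX.
apply: (killing_commuting gP lc sE EE Ec sX) => j u.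
exact: bracket_left_right.
Qed.

Let sX i : smooth_vfield (X i).
Proof. by have [[]] := adapted_field_killing i. Qed.

Definition adapted_mx u : 'M[R]_n := \matrix_(i, k) frame_coord g E (X i) k u.
Local Notation phi := adapted_mx.

Let sphi i k : smooth_fun (fun u => phi u i k).
Proof.
under eq_fun do rewrite mxE.
exact: (smooth_frame_coord gP sE (sX i)).
Qed.

Let phi_F i u : row i (phi u *m F u) = X i u.
Proof.
rewrite row_mul mulmx_sum_row [RHS](frame_expand gP EE u).
by apply: eq_bigr => k _; rewrite !mxE rowK.
Qed.

Let phi1 : phi 1%g = 1%:M.
Proof.
apply/matrixP => i k; rewrite !mxE /frame_coord /E left_vfield1 -ee; congr (g _ _ _).
by rewrite /X; case: eqP => [->|_]; [exact: left_vfield1|exact: right_vfield1].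
Qed.

Let expandE u (v : V) : exists a : 'I_n -> R, v = \sum_j a j *: E j u.
Proof. by exists (fun j => g u v (E j u)); exact: frame_expand. Qed.

(** For [i = o] both sides vanish: row [o] of [phi] is constant and row [o] of [B j] is 0. For the
    other rows [app_commuting] gives structure constants [c m j k], and for [m] different from [o]
    these equal [- gam j m k] by torsion and [gam0]. *)
Let dphi j i k u : vfield_app (E j) (fun w => phi w i k) u = (phi u *m - B j) i k.
Proof.
have [io|io] := eqVneq i o.
  have -> : (fun w => phi w i k) = (fun=> (o == k)%:R).
    by apply/funext => w; rewrite mxE /frame_coord /X io eqxx EE.
  rewrite vfield_app_cst mulmxN !mxE (bigD1 o) //= !mxE gam_o mulr0 add0r.
  rewrite big1 ?oppr0 // => m mo.
  by rewrite !mxE /frame_coord /X io eqxx EE eq_sym (negbTE mo) mul0r.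
have EX j' u' : lie_bracket (E j') (X i) u' = 0.
  by rewrite /X (negbTE io); exact: bracket_left_right.
(* The index [m = o] has to be excluded: this component is constant because brackets have no
   component along [e o], and it is 0 at the unit. *)
have fo w : frame_coord g E (X i) o w = 0.
  rewrite (frame_cst cG (smooth_frame_coord gP sE (sX i) o) expandE _ w 1%g).
    by have /matrixP/(_ i o) := phi1; rewrite !mxE (negbTE io).
  move=> j' u'; rewrite (app_commuting gP lc sE EE Ec (sX i) EX) big1 // => m _.
  by rewrite c_ideal mulr0.
under eq_fun do rewrite mxE.
rewrite (app_commuting gP lc sE EE Ec (sX i) EX) mulmxN !mxE -sumrN.
apply: eq_bigr => m _; rewrite !mxE -mulrN.
have [->|mo] := eqVneq m o; first by rewrite fo !mul0r.
by rewrite -gtors gam0 // sub0r.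
Qed.

(** [dphi] applied to each factor; [- B j] stands to the right of [phi], so the derivation acts
    after the push and the system closes on the pushed tensor. *)
Let d_push p (C : tensor R n p) j i u :
  vfield_app (E j) (fun w => pushM (phi w) C i : R) u =
  derM (- B j) (pushM (phi u) C) i.
Proof.
have sp (l : {ffun 'I_p -> 'I_n}) :
    smooth_fun (fun w => \prod_(k < p) phi w (l k) (i k)).
  by apply: smooth_fun_prod => k; exact: sphi.
have -> : (fun w => pushM (phi w) C i : R) =
    (fun w => \sum_l C l * \prod_(k < p) phi w (l k) (i k)).
  by apply/funext => w; rewrite ffunE.
rewrite vfield_app_sum; last first.
  by move=> l; apply: smooth_funM; [exact: smooth_fun_cst|exact: sp].
rewrite derM_pushM sum_ffunE.
under [RHS]eq_bigr => k _ do rewrite ffunE.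
rewrite exchange_big /=; apply: eq_bigr => l _.
rewrite (vfield_appM _ _ (smooth_fun_cst (C l)) (sp l)) vfield_app_cst mul0r add0r.
rewrite vfield_app_prod; last by move=> k; exact: sphi.
rewrite mulr_sumr; apply: eq_bigr => k _; congr (_ * _).
by apply: eq_bigr => m _; case: eqP => [->|//]; rewrite dphi.
Qed.

(* The squared distance between [pushM (phi u) C] and [C] has zero derivative
   because [B j] acts on tensors by skew-symmetric endomorphisms killing [C]. *)
Lemma push_adapted p (C : tensor R n p) u :
  (forall j, derM (B j) C = 0) -> pushM (phi u) C = C.
Proof.
move=> BC; pose H w i : R := pushM (phi w) C i - C i.
have sT i : smooth_fun (fun w => pushM (phi w) C i : R).
  under eq_fun do rewrite ffunE; apply: smooth_fun_sum => l.
  apply: smooth_funM; first exact: smooth_fun_cst.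
  by apply: smooth_fun_prod => k; exact: sphi.
have sH i : smooth_fun (H ^~ i).
  by apply: smooth_funD; [exact: sT|exact: smooth_fun_cst].
have dH j i w : vfield_app (E j) (H ^~ i) w =
    derM (- B j) (pushM (phi w) C - C) i.
  rewrite /H (vfield_appD _ _ (sT i) (smooth_fun_cst _)) vfield_app_cst addr0 d_push.
  by rewrite linearB /= [derM _ C]derMN BC oppr0 subr0.
have N0 w : \sum_i H w i * H w i = 0.
  rewrite (frame_cst (f := fun w => \sum_i H w i * H w i) cG _ expandE _ w 1%g).
  - rewrite big1 // => i _; by rewrite /H phi1 pushM1 subrr mul0r.
  - by apply: smooth_fun_sum => i; apply: smooth_funM.
  move=> j v; rewrite vfield_app_sum; last by move=> i; apply: smooth_funM.
  pose K := pushM (phi v) C - C.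
  have HK i : H v i = K i by rewrite /K /H !ffunE.
  under eq_bigr => i _ do rewrite (vfield_appM _ _ (sH i) (sH i)) dH -/K HK.
  rewrite big_split /=; under eq_bigr => i _ do rewrite mulrC.
  by rewrite !derM_skew ?addr0 // linearN /= B_skew.
have := N0 u => /eqP; rewrite psumr_eq0; last by move=> i _; rewrite -expr2 sqr_ge0.
move=> /allP Hi; apply/ffunP => i; have := Hi i (mem_index_enum i).
by rewrite /= mulf_eq0 orbb subr_eq0 => /eqP.
Qed.

(** Left translation carries the frame at 1 to the frame at [u], so the coefficients of [S] at 1
    serve everywhere. *)
Lemma left_invariant_frame p (S : G -> tensor R n p) : left_invariant S ->
  exists C, forall u, S u = pushM (F u) C.
Proof.
move=> lS; exists (pushM (invmx (F 1%g)) (S 1%g)) => u.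
have := lS u 1%g; rewrite mulg1 push_tensorE => <-; rewrite pushM_comp.
have [L LP ->] : exists2 L, (forall v : V, v *m L = left_vfield v u) &
    lin1_mx (tangent_map (ltrans u) (1%g : G)) = L.
  by eexists=> // v; exact: (mul_rV_lin1 ('d _ _)).
have -> : F u = F 1%g *m L.
  apply/row_matrixP => i; have Fr w : row i (F w) = E i w by exact: rowK.
  refine (etrans (Fr u) (esym (etrans (row_mul _ _ _) _))).
  have E1 : E i 1%g = e i by exact: left_vfield1.
  by rewrite (Fr 1%g) E1 LP.
by rewrite mulmxA mulVmx // mul1mx.
Qed.

(** Only [B o] can be nonzero, so the Killing operator has a single term, the product of [E o] with
    a symmetric tensor. *)
Lemma killing_coefficients p (S : G -> tensor R n p) C :
  (forall u, S u = pushM (F u) C) -> symmetric_tensor C -> killing g D S ->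
  forall j, derM (B j) C = 0.
Proof.
move=> SC sC kS j; have [->|jo] := eqVneq j o; last by rewrite B0 // derM0.
have := kS 1%g E (frame_orthonormal_near sE EE 1%g).
have -> : S = (fun u => pushM (F u) C) by apply/funext.
rewrite /killing_op (bigD1 o) //= big1 => [|i io]; last first.
  rewrite (conn_frame_field (lc_connection lc) sE DE) B0 //.
  by rewrite derM0 linear0 sym_mul0r.
rewrite addr0 (conn_frame_field (lc_connection lc) sE DE).
(* Pulled back through the frame, [E o] becomes a standard basis vector, as [sym_mul_vec_inj]
   requires. *)
have -> : vec_tensor (E o 1%g) = pushM (F 1%g) (vec_tensor (delta_mx 0 o)).
  by rewrite pushM_vec -rowE rowK.
rewrite -pushM_sym_mul => /(congr1 (pushM (invmx (F 1%g)))).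
rewrite pushM_comp mulmxV // pushM1 linear0 => H.
exact: sym_mul_vec_inj (symmetric_derM _ sC) H.
Qed.

Lemma left_invariant_killing_polynomial p (S : G -> tensor R n p) :
  symmetric_field S -> left_invariant S -> killing g D S ->
  polynomial_in (fun Y => killing_vfield g D Y /\
    (left_invariant_vfield Y \/ right_invariant_vfield Y)) S.
Proof.
move=> [_ symS] lS kS; have [C SC] := left_invariant_frame lS.
have sC : symmetric_tensor C.
  have -> : C = pushM (invmx (F 1%g)) (S 1%g).
    by rewrite SC pushM_comp mulmxV // pushM1.
  exact/symmetric_pushM/symmetric_is_sym/symS.
have BC := killing_coefficients SC sC kS.
pose T : finType := {ffun 'I_p -> 'I_n}.
exists #|T|, (fun j => (p`!)%:R^-1 * C (enum_val j)),
  (fun j k => X ((enum_val j : T) k)); split.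
  by move=> j k; exact: adapted_field_killing.
(* Inserting [phi] leaves [C] fixed and turns the frame [F u] into [phi u *m F u], whose rows are
   the adapted fields; the decomposition of [C] then becomes a polynomial in them. *)
move=> u; rewrite SC -{1}(push_adapted u BC) pushM_comp.
rewrite {1}(symmetric_decomp sC) linear_sum /=.
rewrite (reindex (fun j : 'I_#|T| => enum_val j)) /=; last first.
  by apply: onW_bij; exact: enum_val_bij.
apply: eq_bigr => j _; rewrite linearZ /= pushM_sym_prod; congr (_ *: sym_prod _).
by apply/funext => k; rewrite -rowE phi_F.
Qed.

End FlatAlmostAbelian.

Theorem proposition6p2 (R : realType) (n : nat) (G : lieGroupType R n)
    (g : G -> 'rV[R]_n -> 'rV[R]_n -> R) (D : @tensor_derivative R n G) :
  connected [set: G] ->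
  almost_abelian G ->
  riemannian_metric g ->
  left_invariant_metric g ->
  levi_civita g D ->
  flat D ->
  forall (p : nat) (S : G -> tensor R n p),
    symmetric_field S -> left_invariant S -> killing g D S ->
    polynomial_in
      (fun X => killing_vfield g D X /\
                (left_invariant_vfield X \/ right_invariant_vfield X)) S.
Proof.
move=> cG [h [hn ideal abel]] gP li lc fl p S symS lS kS.
(* The codimension condition forces [n] to be positive, which supplies an index for e_0. *)
have n0 : (0 < n)%N by rewrite -hn.
have [e [ee [eh ho]]] := orthonormal_adapted (metric_linear gP 1%g)
  (Defs.metric_sym gP 1%g) (fun v => @metric_posdef _ _ _ _ gP 1%g v)
  (Ordinal n0) hn.
apply: (left_invariant_killing_polynomial (o := Ordinal n0) cG gP li lc fl ee _ _
  symS lS kS).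
  by move=> i j io jo; apply: abel; exact: eh.
by move=> x i io; apply/ho/ideal/eh.
Qed.
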